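(* Let $M$ be an $n$-dimensional compact manifold and let $(g_{ij}(t),A_i(t),B_{ij}(t))$ be a smooth solution on $M$ (Riemannian metrics, one-forms, two-forms) of the flow $$\frac{\partial g_{ij}}{\partial t}=-2\left[R_{ij}-\frac14H_{ikl}H_j{}^{kl}-F_i{}^kF_{jk}\right],\qquad \frac{\partial A_i}{\partial t}=-\nabla_kF_i{}^k,\qquad \frac{\partial B_{ij}}{\partial t}=\nabla_kH^k{}_{ij}.$$ Then the curvature tensor satisfies the evolution equation $$\begin{aligned}\frac{\partial}{\partial t}R_{ijkl}&=\triangle R_{ijkl}+2(B_{ijkl}-B_{ijlk}-B_{iljk}+B_{ikjl})-g^{pq}(R_{pjkl}R_{qi}+R_{ipkl}R_{qj}+R_{ijpl}R_{qk}+R_{ijkp}R_{ql})\\&\quad+\frac14\big[\nabla_i\nabla_l(H_{kpq}H_j{}^{pq})-\nabla_i\nabla_k(H_{jpq}H_l{}^{pq})-\nabla_j\nabla_l(H_{kpq}H_i{}^{pq})+\nabla_j\nabla_k(H_{ipq}H_l{}^{pq})\big]\\&\quad+\frac14g^{mn}\big(H_{kpq}H_m{}^{pq}R_{ijnl}+H_{mpq}H_l{}^{pq}R_{ijkn}\big)\\&\quad+\nabla_i\nabla_l(F_k{}^pF_{jp})-\nabla_i\nabla_k(F_j{}^pF_{lp})-\nabla_j\nabla_l(F_k{}^pF_{ip})+\nabla_j\nabla_k(F_i{}^pF_{lp})\\&\quad+g^{mn}\big(F_k{}^pF_{mp}R_{ijnl}+F_m{}^pF_{lp}R_{ijkn}\big),\end{aligned}$$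 where $B_{ijkl}=g^{pr}g^{qs}R_{piqj}R_{rksl}$ and $\triangle$ is the Laplacian with respect to the evolving metric.
   Context: $F=dA$, $H=dB$, i.e. $F_{ij}=\partial_iA_j-\partial_jA_i$ and $H_{ijk}=\partial_iB_{jk}+\partial_jB_{ki}+\partial_kB_{ij}$. The four-index tensor $B_{ijkl}$ (quadratic in curvature) is unrelated to the two-form $B_{ij}$. Indices are raised and lowered with the evolving metric $g$, repeated indices are summed, $\nabla$ is its Levi-Civita connection with Christoffel symbols $\Gamma^k_{ij}$, and $\triangle=g^{ij}\nabla_i\nabla_j$. Curvature conventions: $R^k_{ijl}=\partial_i\Gamma^k_{jl}-\partial_j\Gamma^k_{il}+\Gamma^k_{ip}\Gamma^p_{jl}-\Gamma^k_{jp}\Gamma^p_{il}$, $R_{ijkl}=g_{kp}R^p_{ijl}$, $R_{ik}=g^{jl}R_{ijkl}$. *)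

(* Defs.v *)
From HB Require Import structures.
From mathcomp Require Import all_boot all_order all_algebra.
From mathcomp Require Import all_classical all_reals all_analysis.
Set Implicit Arguments.
Unset Strict Implicit.
Unset Printing Implicit Defensive.
Import Order.TTheory GRing.Theory Num.Theory.
Import numFieldNormedType.Exports.
Local Open Scope classical_set_scope.
Local Open Scope ring_scope.

(* All geometric objects are given by their components in the charts of a
   smooth atlas; tensor fields are families of components, one for each chart,
   related on overlaps by the tensor transformation law. *)

Section Smoothness.
Context {R : realType} {n : nat}.
Implicit Types (J : set R) (D : set 'rV[R]_n).

Definition partials (w : seq 'I_n) (f : 'rV[R]_n -> R) : 'rV[R]_n -> R :=
  foldr (fun i h x => 'D_('e_i) h x) f w.

(* C^infinity on an open set [D]: iterated partial derivatives of every order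
   exist and are continuous. *)
Definition smooth_on D (f : 'rV[R]_n -> R) : Prop :=
  forall w : seq 'I_n, {within D, continuous (partials w f)} /\
    forall (i : 'I_n) x, D x -> derivable (partials w f) x 'e_i.

(* Derivative at [t] of a function of time defined on the interval [J]; it is
   one-sided when [t] is an endpoint of [J]. *)
Definition diff_quotient (f : R -> R) (t s : R) : R := (f s - f t) / (s - t).

Definition is_tderiv J (f : R -> R) (t v : R) : Prop :=
  diff_quotient f t s @[s --> within J t^'] --> v.

Definition tderiv J (f : R -> R) (t : R) : R :=
  lim (diff_quotient f t s @[s --> within J t^']).

(* [None] stands for the time direction. *)
Definition st_partial J (d : option 'I_n) (f : R -> 'rV[R]_n -> R) :
    R -> 'rV[R]_n -> R :=
  if d is Some i then fun t x => 'D_('e_i) (f t) x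
  else fun t x => tderiv J (f ^~ x) t.

Definition st_derivable J (d : option 'I_n) (f : R -> 'rV[R]_n -> R)
    (t : R) (x : 'rV[R]_n) : Prop :=
  if d is Some i then derivable (f t) x 'e_i
  else cvg (diff_quotient (f ^~ x) t s @[s --> within J t^']).

Definition st_partials J (w : seq (option 'I_n)) (f : R -> 'rV[R]_n -> R) :
    R -> 'rV[R]_n -> R :=
  foldr (st_partial J) f w.

(* C^infinity on [J `*` D], up to those endpoints of [J] that belong to [J]. *)
Definition st_smooth_on J D (f : R -> 'rV[R]_n -> R) : Prop :=
  forall w : seq (option 'I_n),
    {within J `*` D, continuous (fun p : R * 'rV[R]_n => st_partials J w f p.1 p.2)}
    /\ forall (d : option 'I_n) t x, J t -> D x ->
         st_derivable J d (st_partials J w f) t x.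

End Smoothness.

Section Manifolds.
Context {R : realType} {n : nat}.

Record chart (M : topologicalType) := Chart {
  cdom : set M;
  cmap : M -> 'rV[R]_n;
  cinv : 'rV[R]_n -> M;
  cdom_open : open cdom;
  cimg_open : open (cmap @` cdom);
  cmapK : forall p, cdom p -> cinv (cmap p) = p;
  cmap_continuous : {within cdom, continuous cmap};
  cinv_continuous : {within cmap @` cdom, continuous cinv} }.

Definition cimg (M : topologicalType) (c : chart M) : set 'rV[R]_n :=
  cmap c @` cdom c.

Definition overlap (M : topologicalType) (c c' : chart M) : set 'rV[R]_n :=
  cmap c @` (cdom c `&` cdom c').

Definition transition (M : topologicalType) (c c' : chart M) :
    'rV[R]_n -> 'rV[R]_n :=
  fun x => cmap c' (cinv c x).

Record smooth_manifold := SmoothManifold {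
  carrier :> topologicalType;
  carrier_hausdorff : hausdorff_space carrier;
  carrier_second_countable : @second_countable carrier;
  chart_index : Type;
  charts : chart_index -> chart carrier;
  charts_cover : forall p : carrier, exists a, cdom (charts a) p;
  charts_compatible : forall a b (i : 'I_n),
    smooth_on (overlap (charts a) (charts b))
      (fun x => transition (charts a) (charts b) x 0 i) }.

End Manifolds.
Arguments chart : clear implicits.
Arguments smooth_manifold : clear implicits.

(* Components in one chart of a covariant tensor field: for a field of rank k,
   [T [:: i1; ...; ik] x] is T_{i1...ik} at x.  Only index lists of length k
   are meaningful. *)
Definition tensor (R : realType) (n : nat) : Type :=
  seq 'I_n -> 'rV[R]_n -> R.

Section TensorFields.
Context {R : realType} {n : nat} (M : smooth_manifold R n).
Implicit Type J : set R.

Definition tensor_flow : Type := chart_index M -> R -> tensor R n.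

Definition is_smooth_tensor_flow J (k : nat) (T : tensor_flow) : Prop :=
  (forall a (I : k.-tuple 'I_n),
     st_smooth_on J (cimg (charts a)) (fun t => T a t I)) /\
  (forall a b (I : k.-tuple 'I_n) t x,
     J t -> overlap (charts a) (charts b) x ->
     let y := transition (charts a) (charts b) in
     T a t I x =
       \sum_(K : k.-tuple 'I_n) T b t K (y x) *
         \prod_(s < k) 'D_('e_(tnth I s)) (fun z => y z 0 (tnth K s)) x).

Definition metric_mx (g : tensor R n) (x : 'rV[R]_n) : 'M[R]_n :=
  \matrix_(i, j) g [:: i; j] x.

Definition is_metric_flow J (g : tensor_flow) : Prop :=
  is_smooth_tensor_flow J 2 g /\
  forall a t x, J t -> cimg (charts a) x ->
    (forall i j, g a t [:: i; j] x = g a t [:: j; i] x) /\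
    (forall v : 'rV[R]_n, v != 0 ->
       0 < (v *m metric_mx (g a t) x *m v^T) 0 0).

Definition is_one_form_flow J (A : tensor_flow) : Prop :=
  is_smooth_tensor_flow J 1 A.

Definition is_two_form_flow J (B : tensor_flow) : Prop :=
  is_smooth_tensor_flow J 2 B /\
  forall a t x, J t -> cimg (charts a) x ->
    forall i j, B a t [:: i; j] x = - B a t [:: j; i] x.

End TensorFields.

Section LocalGeometry.
Context {R : realType} {n : nat} (g : tensor R n).
Implicit Types (x : 'rV[R]_n) (T : tensor R n) (i j k l : 'I_n).

Definition ginv i j x : R := invmx (metric_mx g x) i j.

(* Gamma^k_{ij} *)
Definition christoffel k i j x : R :=
  2^-1 * \sum_(l < n) ginv k l x *
    ('D_('e_i) (g [:: j; l]) x + 'D_('e_j) (g [:: i; l]) x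
     - 'D_('e_l) (g [:: i; j]) x).

(* The index of differentiation comes first:
   [nabla T [:: m; i1; ...; ik]] is nabla_m T_{i1...ik}, so that
   [nabla (nabla T) [:: m; l; i1; ...; ik]] is nabla_m nabla_l T_{i1...ik}. *)
Definition nabla T : tensor R n := fun I x =>
  if I is m :: I' then
    'D_('e_m) (T I') x
    - \sum_(s < size I') \sum_(p < n)
        christoffel p m (nth m I' s) x * T (set_nth m I' s p) x
  else 0.

Definition laplacian T : tensor R n := fun I x =>
  \sum_(p < n) \sum_(q < n) ginv p q x * nabla (nabla T) (p :: q :: I) x.

(* R^k_{ijl}, with the upper index as first argument *)
Definition riemann_up k i j l x : R :=
  'D_('e_i) (christoffel k j l) x - 'D_('e_j) (christoffel k i l) x
  + \sum_(p < n) (christoffel k i p x * christoffel p j l x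
                  - christoffel k j p x * christoffel p i l x).

Definition Rm : tensor R n := fun I x =>
  if I is [:: i; j; k; l] then
    \sum_(p < n) g [:: k; p] x * riemann_up p i j l x
  else 0.

Definition Ric : tensor R n := fun I x =>
  if I is [:: i; k] then
    \sum_(j < n) \sum_(l < n) ginv j l x * Rm [:: i; j; k; l] x
  else 0.

(* B_{ijkl} = g^{pr} g^{qs} R_{piqj} R_{rksl} *)
Definition RmRm : tensor R n := fun I x =>
  if I is [:: i; j; k; l] then
    \sum_(p < n) \sum_(q < n) \sum_(r < n) \sum_(s < n)
      ginv p r x * ginv q s x * Rm [:: p; i; q; j] x * Rm [:: r; k; s; l] x
  else 0.

(* F_i^p F_{jp} *)
Definition trFF (F : tensor R n) : tensor R n := fun I x =>
  if I is [:: i; j] then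
    \sum_(p < n) \sum_(q < n) ginv p q x * F [:: i; q] x * F [:: j; p] x
  else 0.

(* H_{ipq} H_j^{pq} *)
Definition trHH (H : tensor R n) : tensor R n := fun I x =>
  if I is [:: i; j] then
    \sum_(p < n) \sum_(q < n) \sum_(r < n) \sum_(s < n)
      ginv p r x * ginv q s x * H [:: i; p; q] x * H [:: j; r; s] x
  else 0.

(* nabla_k F_i^k *)
Definition divF (F : tensor R n) : tensor R n := fun I x =>
  if I is [:: i] then
    \sum_(k < n) \sum_(l < n) ginv k l x * nabla F [:: k; i; l] x
  else 0.

(* nabla_k H^k_{ij} *)
Definition divH (H : tensor R n) : tensor R n := fun I x =>
  if I is [:: i; j] then
    \sum_(k < n) \sum_(l < n) ginv k l x * nabla H [:: k; l; i; j] x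
  else 0.

End LocalGeometry.

Section ExteriorDerivative.
Context {R : realType} {n : nat}.

Definition d1 (A : tensor R n) : tensor R n := fun I x =>
  if I is [:: i; j] then 'D_('e_i) (A [:: j]) x - 'D_('e_j) (A [:: i]) x
  else 0.

Definition d2 (B : tensor R n) : tensor R n := fun I x =>
  if I is [:: i; j; k] then
    'D_('e_i) (B [:: j; k]) x + 'D_('e_j) (B [:: k; i]) x
    + 'D_('e_k) (B [:: i; j]) x
  else 0.

End ExteriorDerivative.

Definition is_smooth_solution {R : realType} {n : nat}
    (M : smooth_manifold R n) (J : set R) (g A B : tensor_flow M) : Prop :=
  [/\ is_metric_flow J g, is_one_form_flow J A, is_two_form_flow J B &
    forall a t x, J t -> cimg (charts a) x ->
      let F := d1 (A a t) in
      let H := d2 (B a t) in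
      [/\ forall i j, is_tderiv J (fun s => g a s [:: i; j] x) t
            (- 2 * (Ric (g a t) [:: i; j] x
                    - 4^-1 * trHH (g a t) H [:: i; j] x
                    - trFF (g a t) F [:: i; j] x)),
          forall i, is_tderiv J (fun s => A a s [:: i] x) t
            (- divF (g a t) F [:: i] x) &
          forall i j, is_tderiv J (fun s => B a s [:: i; j] x) t
            (divH (g a t) H [:: i; j] x)]].

(* Main.v *)
Require Import Defs.
From HB Require Import structures.
From mathcomp Require Import all_boot all_order all_algebra ring lra.
From mathcomp Require Import all_classical all_reals all_analysis.
Set Implicit Arguments.
Unset Strict Implicit.
Unset Printing Implicit Defensive.
Import Order.TTheory GRing.Theory Num.Theory.
Import numFieldNormedType.Exports.
Local Open Scope classical_set_scope.
Local Open Scope ring_scope.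

(** The equation is local, so fix a chart with image U.  Smooth functions of
    (t, x) on J x U form a commutative ring on which d/dt and the coordinate
    derivatives act as pairwise commuting derivations.  The components of g, A
    and B lie in this ring, and so do those of the inverse metric, because
    det g has no zero and is therefore invertible there.  Thus the evolution
    equation is an identity in a commutative ring with commuting derivations,
    in which 2 is invertible, and it is proved in that generality: no limit
    occurs in the tensor calculus, and a tensor is just a family of ring
    elements indexed by lists of indices.

    Algebra.  Write h = dg/dt.  The time derivative of the Christoffel symbols,
    with its upper index lowered, is (1/2)(D_j h_lk + D_l h_jk - D_k h_jl)
    ([dGam_lowP]), where D is the covariant derivative.  Differentiating the
    curvature and using the Ricci identity on D_i D_j h - D_j D_i h gives
    ([d_Riem])
      dR_ijkl/dt = (1/2)(D_i D_l h_kj - D_i D_k h_jl - D_j D_l h_ki + D_j D_k h_il)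
                   + (1/2) g^mp (h_km R_ijpl + h_ml R_ijkp).
    This is linear in h.  For h = -2 (Ric - HH/4 - FF) the HH and FF parts are
    those of the theorem as they stand.  The second derivatives of Ric are
    traded for the Laplacian of the curvature by a purely Riemannian identity
    of Hamilton ([laplacian_Riem]): rewrite g^pq D_p D_q R_ijkl by the second
    Bianchi identity, commute D_p past D_i, evaluate the divergence of the
    curvature by the contracted Bianchi identity ([tr_cov2_Riem]), and sort the
    quadratic terms produced by the commutator with the first Bianchi identity
    ([tr_act_Riem]).  [curvature_evolution] puts the two together.

    Analysis.  The ring exists because smoothness up to the endpoints of J is
    preserved by products and inverses ([smooth_uptoM], [smooth_uptoV]) and
    because mixed partial derivatives commute, also when the time derivative is
    one-sided ([mixed_tderiv], [st_partialC]).  The relation [agree] then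
    identifies each geometric quantity of the chart at time t with the
    evaluation at t of its algebraic counterpart. *)

(** * Lists of indices and the action of matrices on tensors *)
Section SizeInd.
Variables (T : Type) (P : seq T -> Prop).

Lemma size2_ind : (forall i j, P [:: i; j]) -> forall s, size s = 2%N -> P s.
Proof. by move=> h [|i [|j [|? ?]]] //= _. Qed.

Lemma size3_ind : (forall i j k, P [:: i; j; k]) -> forall s, size s = 3%N -> P s.
Proof. by move=> h [|i [|j [|k [|? ?]]]] //= _. Qed.

Lemma size4_ind : (forall i j k l, P [:: i; j; k; l]) ->
  forall s, size s = 4%N -> P s.
Proof. by move=> h [|i [|j [|k [|l [|? ?]]]]] //= _. Qed.

Lemma size5_ind : (forall i j k l m, P [:: i; j; k; l; m]) ->
  forall s, size s = 5%N -> P s.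
Proof. by move=> h [|i [|j [|k [|l [|m [|? ?]]]]]] //= _. Qed.

End SizeInd.

Section Action.
Context {A : comNzRingType} {n : nat}.
Implicit Types (L : 'I_n -> 'I_n -> A) (T U : seq 'I_n -> A) (I : seq 'I_n).

(** The derivation action of an endomorphism L (upper index first) on a covariant
    tensor: the sum over the slots of I of L contracted into that slot.
    Recursing on the list of indices makes the rank arbitrary and lets the
    action unfold by computation on explicit lists. *)
Fixpoint act L T I : A :=
  if I is x :: I' then
    \sum_p L p x * T (p :: I') + act L (fun I => T (x :: I)) I'
  else 0.

Lemma eq_act L T U I :
  (forall I', size I' = size I -> T I' = U I') -> act L T I = act L U I.
Proof.
elim: I T U => //= x I IH T U TU; congr (_ + _).
  by apply: eq_bigr => p _; rewrite TU.
by apply: IH => I' sI; rewrite TU //= sI.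
Qed.

Lemma act0 L I : act L (fun=> 0) I = 0.
Proof.
by elim: I => //= x I ->; rewrite addr0 big1 // => p _; rewrite mulr0.
Qed.

Lemma actD L T U I : act L (fun I => T I + U I) I = act L T I + act L U I.
Proof.
elim: I T U => [|x I IH] T U /=; first by rewrite addr0.
rewrite IH addrACA -big_split; congr (_ + _).
by apply: eq_bigr => p _; rewrite mulrDr.
Qed.

Lemma actZ L c T I : act L (fun I => c * T I) I = c * act L T I.
Proof.
elim: I T => [|x I IH] T /=; first by rewrite mulr0.
rewrite IH mulrDr mulr_sumr; congr (_ + _).
by apply: eq_bigr => p _; ring.
Qed.

Lemma actN L T I : act L (fun I => - T I) I = - act L T I.
Proof.
rewrite -mulN1r -actZ; apply: eq_act => I' _; by rewrite mulN1r.
Qed.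

Lemma act_sum L (s : seq 'I_n) (T : 'I_n -> seq 'I_n -> A) I :
  act L (fun I => \sum_(i <- s) T i I) I = \sum_(i <- s) act L (T i) I.
Proof.
elim: s => [|i s IH].
  rewrite big_nil -[RHS](act0 L I); apply: eq_act => I' _; by rewrite big_nil.
rewrite big_cons -IH -actD; apply: eq_act => I' _; by rewrite big_cons.
Qed.

Lemma actDl L L' T I :
  act (fun p l => L p l + L' p l) T I = act L T I + act L' T I.
Proof.
elim: I T => [|x I IH] T /=; first by rewrite addr0.
rewrite IH addrACA -big_split; congr (_ + _).
by apply: eq_bigr => p _; rewrite mulrDl.
Qed.

Lemma actNl L T I : act (fun p l => - L p l) T I = - act L T I.
Proof.
elim: I T => [|x I IH] T /=; first by rewrite oppr0.
rewrite IH opprD -sumrN; congr (_ + _).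
by apply: eq_bigr => p _; rewrite mulNr.
Qed.

(** The action is a representation of the Lie algebra of matrices: contributions
    in two different slots commute, so only the bracket within one slot remains.
    The minus sign of covariant slots shows in the order of the factors. *)
Lemma act_comm L L' T I :
  act L (act L' T) I - act L' (act L T) I =
  act (fun p l => \sum_q (L q l * L' p q - L' q l * L p q)) T I.
Proof.
elim: I T => [|x I IH] T /=; first by rewrite subr0.
rewrite -IH !actD !act_sum.
have E M M' : \sum_p M p x * (\sum_q M' q p * T (q :: I)
     + act M' (fun J => T (p :: J)) I) =
   \sum_p (\sum_q M q x * M' p q) * T (p :: I) +
   \sum_p M p x * act M' (fun J => T (p :: J)) I.
  under eq_bigr do rewrite mulrDr.
  rewrite big_split; congr (_ + _) => /=.
  under eq_bigr do rewrite mulr_sumr.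
  rewrite exchange_big; apply: eq_bigr => p _.
  rewrite mulr_suml; apply: eq_bigr => q _; by rewrite mulrA.
rewrite !E.
under [X in _ + (X + _) - _]eq_bigr do rewrite actZ.
under [X in _ - (_ + (X + _))]eq_bigr do rewrite actZ.
under [X in _ = X + _]eq_bigr do rewrite sumrB mulrBl.
rewrite sumrB; ring.
Qed.

(** Fixed permutations of the slots commute with the action, hence with
    covariant differentiation; this transports symmetries of a tensor to its
    covariant derivatives of all orders. *)
Definition reindexing k (s : seq 'I_n -> seq 'I_n) :=
  forall L T I, size I = k -> act L (fun I => T (s I)) I = act L T (s I).

Definition reindex_tail (s : seq 'I_n -> seq 'I_n) I :=
  if I is m :: I' then m :: s I' else [::].

Lemma reindexing_tail k s : reindexing k s -> reindexing k.+1 (reindex_tail s).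
Proof. by move=> sP L T [|m I] //= [Ik]; rewrite (sP _ (fun J => T (m :: J))). Qed.

Definition third_first I := if I is [:: p, q, l & J] then [:: l, p, q & J] else I.

Lemma reindexing_third_first k : reindexing k.+3 third_first.
Proof. by move=> L T [|p [|q [|l I]]] //= _; ring. Qed.

Definition upper_third I := if I is [:: k; i; j; l] then [:: i; j; k; l] else I.

Lemma reindexing_upper_third : reindexing 4 upper_third.
Proof. by move=> L T [|i [|j [|k [|l []]]]] //= _; ring. Qed.

Definition rot_three I := if I is [:: m, i, j & J] then [:: i, j, m & J] else I.

Lemma reindexing_rot_three k : reindexing k.+3 rot_three.
Proof. by move=> L T [|p [|q [|l I]]] //= _; ring. Qed.

Definition swap_two I := if I is [:: i, j & J] then [:: j, i & J] else I.

Lemma reindexing_swap_two k : reindexing k.+2 swap_two.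
Proof. by move=> L T [|p [|q I]] //= _; ring. Qed.

Definition swap_pairs I := if I is [:: i; j; k; l] then [:: k; l; i; j] else I.

Lemma reindexing_swap_pairs : reindexing 4 swap_pairs.
Proof. by move=> L T [|p [|q [|r [|s []]]]] //= _; ring. Qed.

Definition interleave I := if I is [:: p; q; i; k] then [:: i; p; k; q] else I.

Lemma reindexing_interleave : reindexing 4 interleave.
Proof. by move=> L T [|p [|q [|r [|s []]]]] //= _; ring. Qed.

Definition reverse_three I := if I is [:: k; j; l] then [:: l; j; k] else I.

Lemma reindexing_reverse_three : reindexing 3 reverse_three.
Proof. by move=> L T [|p [|q [|r []]]] //= _; ring. Qed.

End Action.

(** * Covariant derivatives and the Ricci identity *)

Section Tensors.
Context {A : comNzRingType} {n : nat}.
Variable d : option 'I_n -> {additive A -> A}.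
Hypothesis dM : forall m a b, d m (a * b) = d m a * b + a * d m b.
Hypothesis dC : forall m m' a, d m (d m' a) = d m' (d m a).
Variable C : 'I_n -> 'I_n -> 'I_n -> A.
Hypothesis Csym : forall k i j, C k i j = C k j i.
Implicit Types (T U : seq 'I_n -> A) (I : seq 'I_n).

(** C k i j stands for the Christoffel symbol with upper index k of an arbitrary
    connection. *)
Definition cov_deriv T I : A :=
  if I is m :: I' then d (Some m) (T I') - act (fun p l => C p m l) T I'
  else 0.

Local Notation cov := cov_deriv.

Definition curv_up k i j l : A :=
  d (Some i) (C k j l) - d (Some j) (C k i l)
  + \sum_p (C k i p * C p j l - C k j p * C p i l).

Local Notation curv := curv_up.

Lemma der1 m : d m 1 = 0.
Proof.
have := dM m 1 1; rewrite !mulr1 mul1r => /esym/eqP.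
by rewrite -subr_eq0 addrK => /eqP.
Qed.

Lemma d_act m (L : 'I_n -> 'I_n -> A) T I :
  d m (act L T I) =
  act (fun p l => d m (L p l)) T I + act L (fun I => d m (T I)) I.
Proof.
elim: I T => [|x I IH] T /=; first by rewrite raddf0 addr0.
rewrite raddfD IH addrACA raddf_sum -big_split; congr (_ + _).
by apply: eq_bigr => p _; rewrite dM.
Qed.

Lemma eq_cov T U I :
  (forall I', (size I').+1 = size I -> T I' = U I') -> cov T I = cov U I.
Proof.
case: I => //= m I TU; rewrite TU // (eq_act _ (U := U)) // => I' sI.
by rewrite TU ?sI.
Qed.

Lemma covD T U I : cov (fun I => T I + U I) I = cov T I + cov U I.
Proof. by case: I => [|m I] /=; rewrite ?addr0 // raddfD actD; ring. Qed.

Lemma covN T I : cov (fun I => - T I) I = - cov T I.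
Proof. by case: I => [|m I] /=; rewrite ?oppr0 // raddfN actN; ring. Qed.

Lemma covB T U I : cov (fun I => T I - U I) I = cov T I - cov U I.
Proof. by rewrite covD covN. Qed.

Lemma covZ c T I : (forall m, d m c = 0) ->
  cov (fun I => c * T I) I = c * cov T I.
Proof.
move=> dc; case: I => [|m I] /=; rewrite ?mulr0 // dM dc actZ; ring.
Qed.

Lemma cov2D T U I : cov (cov (fun I => T I + U I)) I = cov (cov T) I + cov (cov U) I.
Proof. by rewrite -covD; apply: eq_cov => I' _; rewrite covD. Qed.

Lemma cov2Z c T I : (forall m, d m c = 0) ->
  cov (cov (fun I => c * T I)) I = c * cov (cov T) I.
Proof. by move=> dc; rewrite -covZ //; apply: eq_cov => I' _; rewrite covZ. Qed.

Lemma cov2E i j T I :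
  cov (cov T) [:: i, j & I] =
  d (Some i) (d (Some j) (T I))
  - act (fun p l => d (Some i) (C p j l)) T I
  - act (fun p l => C p j l) (fun I => d (Some i) (T I)) I
  - \sum_p C p i j * cov T (p :: I)
  - act (fun p l => C p i l) (fun I => d (Some j) (T I)) I
  + act (fun p l => C p i l) (act (fun p l => C p j l) T) I.
Proof. by rewrite /= raddfB d_act actD actN; ring. Qed.

(** In D_i D_j T the connection term that acts on the slot j is symmetric in i
    and j, as the connection is torsion-free; what survives antisymmetrisation is
    the derivative of the connection and, by [act_comm], its commutator, which
    together are the curvature. *)
Lemma ricci_identity i j T I :
  cov (cov T) [:: i, j & I] - cov (cov T) [:: j, i & I] =
  - act (fun p l => curv p i j l) T I.
Proof.
rewrite !cov2E dC.
have -> : \sum_p C p j i * cov T (p :: I) = \sum_p C p i j * cov T (p :: I).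
  by apply: eq_bigr => p _; rewrite Csym.
have /eqP := act_comm (fun p l => C p i l) (fun p l => C p j l) T I.
rewrite subr_eq => /eqP ->.
rewrite /curv actDl (actDl _ (fun p l => - d (Some j) (C p i l))) actNl.
set X := act (fun p l => \sum_q _) T I; set Y := act (fun p l => \sum_q _) T I.
suff -> : X = - Y by ring.
rewrite -actNl /X; congr (act _ T I); apply/funext => p; apply/funext => l.
by rewrite -sumrN; apply: eq_bigr => q _; ring.
Qed.

Lemma cov_reindex k s T m I : reindexing (A := A) k s -> size I = k ->
  cov (fun I => T (s I)) (m :: I) = cov T (m :: s I).
Proof. by move=> sP Ik /=; rewrite sP. Qed.

Lemma cov2_reindex k s T m m' I : reindexing (A := A) k s -> size I = k ->
  cov (cov (fun I => T (s I))) [:: m, m' & I] = cov (cov T) [:: m, m' & s I].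
Proof.
move=> sP Ik.
transitivity (cov (fun J => cov T (reindex_tail s J)) [:: m, m' & I]).
  apply: eq_cov => -[|a J] // [Jk].
  by rewrite (cov_reindex _ _ sP) ?Jk.
by rewrite (cov_reindex _ _ (reindexing_tail sP)) //= Ik.
Qed.

Lemma cov2_reindexZ k s T c : reindexing (A := A) k s -> (forall m, d m c = 0) ->
  (forall I, size I = k -> T (s I) = c * T I) ->
  forall m m' I, size I = k ->
  cov (cov T) [:: m, m' & s I] = c * cov (cov T) [:: m, m' & I].
Proof.
move=> sP dc Tc m m' I Ik; rewrite -(cov2_reindex _ _ _ sP) // -cov2Z //.
apply: eq_cov => J [Jk]; apply: eq_cov => J' [Jk']; apply: Tc; congruence.
Qed.

(** For a metric connection, lowering an index commutes with covariant
    differentiation.  V is a tensor with one upper index p; the bracket on the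
    right is its covariant derivative. *)
Lemma cov_lower (g : 'I_n -> 'I_n -> A) (V : 'I_n -> seq 'I_n -> A) T m k I :
  (forall m i j, d (Some m) (g i j) =
     \sum_p C p m i * g p j + \sum_p C p m j * g i p) ->
  (forall k I, T (k :: I) = \sum_p g k p * V p I) ->
  cov T [:: m, k & I] =
  \sum_p g k p * (d (Some m) (V p I) + \sum_q C p m q * V q I
                  - act (fun p l => C p m l) (V p) I).
Proof.
move=> dg TV; rewrite /= TV raddf_sum.
under [X in X - _]eq_bigr do rewrite dM dg.
have -> : (fun I => T (k :: I)) = (fun I => \sum_p g k p * V p I).
  by apply/funext => J.
rewrite act_sum.
under [X in _ - (_ + X)]eq_bigr do rewrite actZ.
under [X in _ - (X + _)]eq_bigr do rewrite TV.
under [RHS]eq_bigr do rewrite mulrBr mulrDr.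
rewrite sumrB !big_split /=.
under [X in X + _ - _]eq_bigr do rewrite mulrDl.
rewrite big_split /=.
have -> : \sum_p C p m k * (\sum_q g p q * V q I) =
  \sum_p (\sum_q C q m k * g q p) * V p I.
  under eq_bigr do rewrite mulr_sumr.
  rewrite exchange_big; apply: eq_bigr => p _; rewrite mulr_suml.
  by apply: eq_bigr => q _; rewrite mulrA.
have -> : \sum_p g k p * (\sum_q C p m q * V q I) =
  \sum_p (\sum_q C q m p * g k q) * V p I.
  under eq_bigr do rewrite mulr_sumr.
  rewrite exchange_big; apply: eq_bigr => p _; rewrite mulr_suml.
  by apply: eq_bigr => q _; ring.
ring.
Qed.

End Tensors.

(** * Levi-Civita connections over a ring with derivations *)
Section Metric.
Context {A : comNzRingType} {n : nat}.
Variable d : option 'I_n -> {additive A -> A}.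
Hypothesis dM : forall m a b, d m (a * b) = d m a * b + a * d m b.
Hypothesis dC : forall m m' a, d m (d m' a) = d m' (d m a).
Variables (half : A) (g : seq 'I_n -> A) (gi : 'I_n -> 'I_n -> A).
Hypothesis halfP : half + half = 1.
Hypothesis gsym : forall i j, g [:: i; j] = g [:: j; i].
Hypothesis gisym : forall i j, gi i j = gi j i.
Hypothesis giP : forall i j, \sum_p gi i p * g [:: p; j] = (i == j)%:R.
Implicit Types (T U : seq 'I_n -> A) (I : seq 'I_n) (f h : 'I_n -> 'I_n -> A).

(** Division by 2 is multiplication by the element half. *)
Lemma double_inj (x y : A) : x + x = y + y -> x = y.
Proof.
by move=> e; rewrite -[x]mul1r -[y]mul1r -halfP !mulrDl -!mulrDr e.
Qed.

Lemma eq_add0 (z x y : A) : z = 0 -> x = y + z -> x = y.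
Proof. by move=> ->; rewrite addr0. Qed.

Lemma eq_sub0 (z x y : A) : z = 0 -> x = y - z -> x = y.
Proof. by move=> ->; rewrite subr0. Qed.

Lemma der_half m : d m half = 0.
Proof.
apply: double_inj; rewrite -raddfD halfP addr0; exact: der1.
Qed.

Lemma sum_delta (k : 'I_n) (f : 'I_n -> A) : \sum_p (k == p)%:R * f p = f k.
Proof.
rewrite (bigD1 k) //= eqxx mul1r big1 ?addr0 // => p /negbTE.
by rewrite eq_sym => ->; rewrite mul0r.
Qed.

Lemma raiseK k (f : 'I_n -> A) : \sum_p gi k p * (\sum_q g [:: p; q] * f q) = f k.
Proof.
under eq_bigr do rewrite mulr_sumr.
rewrite exchange_big -[RHS]sum_delta; apply: eq_bigr => q _.
by rewrite -giP mulr_suml; apply: eq_bigr => p _; rewrite mulrA.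
Qed.

Lemma giPr i j : \sum_p g [:: i; p] * gi p j = (i == j)%:R.
Proof.
rewrite eq_sym -giP; apply: eq_bigr => p _.
by rewrite mulrC gsym gisym.
Qed.

Lemma lowerK k (f : 'I_n -> A) : \sum_p g [:: k; p] * (\sum_q gi p q * f q) = f k.
Proof.
under eq_bigr do rewrite mulr_sumr.
rewrite exchange_big -[RHS]sum_delta; apply: eq_bigr => q _.
by rewrite -giPr mulr_suml; apply: eq_bigr => p _; rewrite mulrA.
Qed.

Definition Gam k i j : A :=
  half * \sum_l gi k l *
    (d (Some i) (g [:: j; l]) + d (Some j) (g [:: i; l]) - d (Some l) (g [:: i; j])).

Lemma Gam_sym k i j : Gam k i j = Gam k j i.
Proof.
rewrite /Gam; congr (_ * _); apply: eq_bigr => l _.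
by rewrite (gsym j i); congr (_ * _); ring.
Qed.

Lemma Gam_lower k i j : \sum_p g [:: k; p] * Gam p i j =
  half * (d (Some i) (g [:: j; k]) + d (Some j) (g [:: i; k])
          - d (Some k) (g [:: i; j])).
Proof.
under eq_bigr do rewrite /Gam mulrCA.
by rewrite -mulr_sumr lowerK.
Qed.

(** The two lowered Christoffel symbols add up to 1/2 of twice the derivative of
    g, the other four terms cancelling in pairs. *)
Lemma metric_compat m i j : d (Some m) (g [:: i; j]) =
  \sum_p Gam p m i * g [:: p; j] + \sum_p Gam p m j * g [:: i; p].
Proof.
under eq_bigr do rewrite gsym mulrC.
under [X in _ + X]eq_bigr do rewrite mulrC.
rewrite !Gam_lower (gsym j i) -[LHS]mul1r -halfP; ring.
Qed.

Local Notation cov := (cov_deriv d Gam).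
Local Notation curv := (curv_up d Gam).

Lemma cov_metric I : size I = 3%N -> cov g I = 0.
Proof.
move: I => [|m [|i [|j []]]] //= _; rewrite addr0 metric_compat; ring.
Qed.

(** Differentiate gi * g = 1, insert the derivative of g, and cancel g on the
    right. *)
Lemma d_gi m i j : d (Some m) (gi i j) =
  - \sum_p Gam i m p * gi p j - \sum_p Gam j m p * gi i p.
Proof.
have E q : \sum_p d (Some m) (gi i p) * g [:: p; q] =
    - (\sum_p (\sum_r gi i r * Gam p m r) * g [:: p; q]) - Gam i m q.
  have : d (Some m) (\sum_p gi i p * g [:: p; q]) = 0.
    rewrite giP; case: (i == q); first exact: der1.
    exact: raddf0.
  rewrite raddf_sum.
  under eq_bigr do rewrite dM metric_compat mulrDr.
  rewrite !big_split /=.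
  have -> : \sum_p gi i p * (\sum_p0 Gam p0 m q * g [:: p; p0]) = Gam i m q.
    rewrite -[RHS](raiseK i (fun p => Gam p m q)); apply: eq_bigr => p _.
    by congr (_ * _); apply: eq_bigr => r _; rewrite mulrC.
  have -> : \sum_p gi i p * (\sum_p0 Gam p0 m p * g [:: p0; q]) =
     \sum_p (\sum_r gi i r * Gam p m r) * g [:: p; q].
    under eq_bigr do rewrite mulr_sumr.
    rewrite exchange_big; apply: eq_bigr => p _; rewrite mulr_suml.
    by apply: eq_bigr => r _; rewrite mulrA.
  move=> /eqP; rewrite addr_eq0 => /eqP ->; ring.
(* cancellation of g on the right *)
have K (f : 'I_n -> A) : f j = \sum_q (\sum_p f p * g [:: p; q]) * gi q j.
  rewrite -[LHS](sum_delta j f).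
  under [RHS]eq_bigr do rewrite mulr_suml.
  rewrite exchange_big; apply: eq_bigr => p _ /=.
  by rewrite eq_sym -giPr mulr_suml; apply: eq_bigr => q _; ring.
rewrite (K (fun p => d (Some m) (gi i p))).
under eq_bigr do rewrite E mulrBl mulNr.
rewrite sumrB sumrN -(K (fun p => \sum_r gi i r * Gam p m r)).
rewrite -[RHS]addrC; congr (- _ - _).
by apply: eq_bigr => p _; rewrite mulrC.
Qed.

Definition tr f : A := \sum_p \sum_q gi p q * f p q.

Lemma eq_tr f h : (forall p q, f p q = h p q) -> tr f = tr h.
Proof. by move=> fh; do 2!(apply: eq_bigr => ? _); rewrite fh. Qed.

Lemma trD f h : tr (fun p q => f p q + h p q) = tr f + tr h.
Proof.
rewrite /tr -big_split; apply: eq_bigr => p _; rewrite -big_split.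
by apply: eq_bigr => q _; rewrite mulrDr.
Qed.

Lemma trN f : tr (fun p q => - f p q) = - tr f.
Proof.
rewrite /tr -sumrN; apply: eq_bigr => p _; rewrite -sumrN.
by apply: eq_bigr => q _; rewrite mulrN.
Qed.

Lemma trB f h : tr (fun p q => f p q - h p q) = tr f - tr h.
Proof. by rewrite trD trN. Qed.

Lemma tr_sum (f : 'I_n -> 'I_n -> 'I_n -> A) :
  tr (fun p q => \sum_r f r p q) = \sum_r tr (f r).
Proof.
rewrite /tr; under eq_bigr do under eq_bigr do rewrite mulr_sumr.
under eq_bigr do rewrite exchange_big.
by rewrite exchange_big.
Qed.

Lemma trZr f c : tr (fun p q => f p q * c) = tr f * c.
Proof.
rewrite /tr mulr_suml; apply: eq_bigr => p _; rewrite mulr_suml.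
by apply: eq_bigr => q _; rewrite mulrA.
Qed.

Lemma trZl f c : tr (fun p q => c * f p q) = c * tr f.
Proof. by rewrite mulrC -trZr; apply: eq_tr => p q; rewrite mulrC. Qed.

Lemma trC f : tr (fun p q => f q p) = tr f.
Proof.
by rewrite /tr exchange_big; do 2!(apply: eq_bigr => ? _); rewrite gisym.
Qed.

(** The inverse metric is parallel, so contraction commutes with D; the two slots
    contracted come first, other contractions are reduced to this one by
    reindexing. *)
Lemma cov_tr T m I : cov (fun I => tr (fun p q => T [:: p, q & I])) (m :: I) =
  tr (fun p q => cov T [:: m, p, q & I]).
Proof.
rewrite /= {1 2}/tr raddf_sum.
under eq_bigr do rewrite raddf_sum.
under eq_bigr do under eq_bigr do rewrite dM d_gi.
rewrite act_sum.
under [X in _ - X]eq_bigr do rewrite act_sum.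
under [X in _ - X]eq_bigr do under eq_bigr do rewrite actZ.
rewrite -/(tr (fun p q => act _ (fun I => T [:: p, q & I]) I)).
have -> : \sum_p \sum_q
   ((- (\sum_r Gam p m r * gi r q) - \sum_r Gam q m r * gi p r)
     * T [:: p, q & I] + gi p q * d (Some m) (T [:: p, q & I])) =
  tr (fun p q => - (\sum_r Gam r m p * T [:: r, q & I])) +
  tr (fun p q => - (\sum_r Gam r m q * T [:: p, r & I])) +
  tr (fun p q => d (Some m) (T [:: p, q & I])).
  under eq_bigr do under eq_bigr do rewrite mulrDl !mulNr.
  under eq_bigr do rewrite !big_split /= !sumrN.
  rewrite !big_split /= !sumrN !trN; congr (- _ - _ + _).
    rewrite /tr [RHS]exchange_big [LHS]exchange_big; apply: eq_bigr => q _ /=.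
    under eq_bigr do rewrite mulr_suml.
    under [RHS]eq_bigr do rewrite mulr_sumr.
    by rewrite exchange_big; do 2!(apply: eq_bigr => ? _) => /=; ring.
  apply: eq_bigr => p _.
  under eq_bigr do rewrite mulr_suml.
  under [RHS]eq_bigr do rewrite mulr_sumr.
  by rewrite exchange_big; do 2!(apply: eq_bigr => ? _) => /=; ring.
rewrite -!trD -trB; apply: eq_tr => p q; ring.
Qed.

Lemma cov2_tr T m l I :
  cov (cov (fun I => tr (fun p q => T [:: p, q & I]))) [:: m, l & I] =
  tr (fun p q => cov (cov T) [:: m, l, p, q & I]).
Proof.
transitivity (cov (fun J => tr (fun p q => cov T (third_first [:: p, q & J])))
                [:: m, l & I]).
  by apply: eq_cov => -[|a J] // _; rewrite cov_tr.
rewrite (cov_tr (fun J => cov T (third_first J))); apply: eq_tr => p q.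
by rewrite (cov_reindex _ _ _ _ (reindexing_third_first (k := size I))).
Qed.

(** * Symmetries of the curvature tensor and the Bianchi identities *)

Definition Riem I : A :=
  if I is [:: i; j; k; l] then \sum_p g [:: k; p] * curv p i j l else 0.

Lemma curv_anti k i j l : curv k j i l = - curv k i j l.
Proof.
rewrite /curv_up.
have -> : \sum_p (Gam k j p * Gam p i l - Gam k i p * Gam p j l) =
  - \sum_p (Gam k i p * Gam p j l - Gam k j p * Gam p i l).
  by rewrite -sumrN; apply: eq_bigr => p _; ring.
ring.
Qed.

Lemma curv_bianchi1 k i j l : curv k i j l + curv k j l i + curv k l i j = 0.
Proof.
rewrite /curv_up !sumrB (Gam_sym k l i) (Gam_sym k l j) (Gam_sym k j i).
have S x y z : \sum_p Gam k x p * Gam p z y = \sum_p Gam k x p * Gam p y z.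
  by apply: eq_bigr => p _; rewrite (Gam_sym p z y).
rewrite (S i l j) (S j l i) (S l i j); ring.
Qed.

Lemma curv_raise k i j l : curv k i j l = \sum_p gi k p * Riem [:: i; j; p; l].
Proof. by rewrite /= raiseK. Qed.

Lemma Riem_anti12 i j k l : Riem [:: j; i; k; l] = - Riem [:: i; j; k; l].
Proof.
by rewrite /= -sumrN; apply: eq_bigr => p _; rewrite curv_anti mulrN.
Qed.

(** The Ricci identity applied to the parallel tensor g says that the curvature
    acts on g trivially. *)
Lemma Riem_anti34 i j k l : Riem [:: i; j; l; k] = - Riem [:: i; j; k; l].
Proof.
have Z I : size I = 4%N -> cov (cov g) I = 0.
  case: I => // m I [sI]; rewrite (eq_cov _ _ (U := fun=> 0)).
    by rewrite /= raddf0 act0 subrr.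
  by move=> I' [sI']; rewrite cov_metric // sI' sI.
have := ricci_identity dM dC Gam_sym i j g [:: k; l].
rewrite !Z // subrr => /esym/eqP; rewrite oppr_eq0 /= addr0.
under eq_bigr do rewrite mulrC gsym.
under [X in _ + X]eq_bigr do rewrite mulrC.
by rewrite addr_eq0 => /eqP ->.
Qed.

Lemma Riem_bianchi1 i j k l :
  Riem [:: i; j; k; l] + Riem [:: j; l; k; i] + Riem [:: l; i; k; j] = 0.
Proof.
rewrite /= -!big_split big1 // => p _ /=.
by rewrite -!mulrDr curv_bianchi1 mulr0.
Qed.

(** The octahedron argument: an alternating sum of four instances of the first
    Bianchi identity leaves twice the difference of the two sides. *)
Lemma Riem_pair i j k l : Riem [:: k; l; i; j] = Riem [:: i; j; k; l].
Proof.
apply: double_inj.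
have e1 := Riem_bianchi1 i j k l; have e2 := Riem_bianchi1 j i l k.
have e3 := Riem_bianchi1 k l i j; have e4 := Riem_bianchi1 l k j i.
move: e1 e2 e3 e4.
rewrite (Riem_anti34 j l i k) (Riem_anti12 i l) (Riem_anti34 i l j k).
rewrite (Riem_anti12 i j l k) (Riem_anti34 i j k l).
rewrite (Riem_anti34 i k j l) (Riem_anti12 j k l i) (Riem_anti34 j k i l).
rewrite (Riem_anti12 j l i k).
rewrite (Riem_anti12 k l j i) (Riem_anti34 k l i j) (Riem_anti12 i k j l).
move=> e1 e2 e3 e4; apply: (eq_sub0 e1); apply: (eq_sub0 e2).
apply: (eq_add0 e3); apply: (eq_add0 e4); ring.
Qed.

(** Seen as matrices in (k, l), connection and curvature satisfy
    R_ij = d_i G_j - d_j G_i + [G_i, G_j]; the second Bianchi identity then is an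
    identity between noncommutative polynomials in the G_i and their
    derivatives. *)
Definition dmx m (X : 'M[A]_n) : 'M[A]_n := map_mx (d (Some m)) X.

Lemma addmxE (X Y : 'M[A]_n) i j : (X + Y) i j = X i j + Y i j.
Proof. exact: mxE. Qed.

Lemma oppmxE (X : 'M[A]_n) i j : (- X) i j = - X i j.
Proof. exact: mxE. Qed.

Lemma dmxM m X Y : dmx m (X *m Y) = dmx m X *m Y + X *m dmx m Y.
Proof.
apply/matrixP => i j; rewrite !mxE raddf_sum -big_split.
by apply: eq_bigr => k _; rewrite !mxE dM.
Qed.

Lemma dmxD m X Y : dmx m (X + Y) = dmx m X + dmx m Y.
Proof. by apply/matrixP => i j; rewrite !mxE raddfD. Qed.

Lemma dmxN m X : dmx m (- X) = - dmx m X.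
Proof. by apply/matrixP => i j; rewrite !mxE raddfN. Qed.

Lemma dmxC m m' X : dmx m (dmx m' X) = dmx m' (dmx m X).
Proof. by apply/matrixP => i j; rewrite !mxE dC. Qed.

Definition Gam_mx i : 'M[A]_n := \matrix_(k, l) Gam k i l.

Definition curv_mx i j : 'M[A]_n :=
  dmx i (Gam_mx j) - dmx j (Gam_mx i)
  + (Gam_mx i *m Gam_mx j - Gam_mx j *m Gam_mx i).

Lemma curv_mxE i j k l : curv_mx i j k l = curv k i j l.
Proof.
rewrite !mxE -sumrB; congr (_ + _); apply: eq_bigr => p _; by rewrite !mxE.
Qed.

Lemma curv_mx_bianchi2 m i j :
  let D m i j := dmx m (curv_mx i j)
    + (Gam_mx m *m curv_mx i j - curv_mx i j *m Gam_mx m) in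
  D m i j + D i j m + D j m i = 0.
Proof.
move=> D; rewrite /D /curv_mx.
rewrite !(dmxD, dmxN, dmxM, mulmxDl, mulmxDr, mulmxBl, mulmxBr, mulNmx, mulmxN).
rewrite !mulmxA (dmxC i m) (dmxC j m) (dmxC j i).
apply/matrixP => x y; rewrite !(addmxE, oppmxE) [RHS]mxE; ring.
Qed.

(** Covariant derivative of the curvature with its upper index k. *)
Definition dcurv m i j k l : A :=
  d (Some m) (curv k i j l) + \sum_q Gam k m q * curv q i j l
  - (\sum_r Gam r m i * curv k r j l
     + (\sum_r Gam r m j * curv k i r l + \sum_r Gam r m l * curv k i j r)).

(** The terms in which the connection acts on the slots i and j drop out of the
    cyclic sum because the connection is symmetric and the curvature
    antisymmetric. *)
Lemma dcurv_bianchi2 m i j k l :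
  dcurv m i j k l + dcurv i j m k l + dcurv j m i k l = 0.
Proof.
have := curv_mx_bianchi2 m i j => /matrixP /(_ k l).
have E a b c : (dmx a (curv_mx b c) +
   (Gam_mx a *m curv_mx b c - curv_mx b c *m Gam_mx a)) k l =
   d (Some a) (curv k b c l) + \sum_q Gam k a q * curv q b c l
   - \sum_r Gam r a l * curv k b c r.
  rewrite addmxE [dmx _ _ _ _]mxE curv_mxE -addrA; congr (_ + _).
  rewrite addmxE oppmxE [X in X - _]mxE [X in _ - X]mxE.
  congr (_ - _); apply: eq_bigr => q _; first by rewrite curv_mxE mxE.
  by rewrite curv_mxE mxE mulrC.
rewrite 2!addmxE !E [RHS]mxE /dcurv => e.
have S a b c : \sum_r Gam r a b * curv k r c l = - \sum_r Gam r b a * curv k c r l.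
  by rewrite -sumrN; apply: eq_bigr => r _; rewrite Gam_sym curv_anti mulrN.
rewrite (S m i j) (S i j m) (S j m i); apply: (eq_add0 e); ring.
Qed.

Lemma cov_Riem m i j k l :
  cov Riem [:: m; i; j; k; l] = \sum_p g [:: k; p] * dcurv m i j p l.
Proof.
pose V p J := if J is [:: i; j; l] then curv p i j l else 0.
pose T J := if J is k :: J' then \sum_p g [:: k; p] * V p J' else 0.
transitivity (cov T [:: m; k; i; j; l]).
  have := cov_reindex d Gam Riem m (I := [:: k; i; j; l])
    (reindexing_upper_third (A := A)) erefl.
  by rewrite [upper_third _]/= => <-; apply: eq_cov => -[|? [|? [|? [|? []]]]].
rewrite (cov_lower dM (g := fun i j => g [:: i; j]) (V := V) m k) //.
  by apply: eq_bigr => p _; rewrite /= addr0.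
exact: metric_compat.
Qed.

Lemma Riem_bianchi2 m i j k l :
  cov Riem [:: m; i; j; k; l] + cov Riem [:: i; j; m; k; l]
  + cov Riem [:: j; m; i; k; l] = 0.
Proof.
rewrite !cov_Riem -!big_split big1 // => p _ /=.
by rewrite -!mulrDr dcurv_bianchi2 mulr0.
Qed.


(** * The Laplacian of the curvature tensor *)

Local Notation cov2 T := (cov (cov T)).

Lemma der_opp1 m : d m (- 1) = 0.
Proof. by rewrite raddfN (der1 dM) oppr0. Qed.

Lemma cov2_Riem_anti12 m m' i j k l :
  cov2 Riem [:: m; m'; j; i; k; l] = - cov2 Riem [:: m; m'; i; j; k; l].
Proof.
rewrite -mulN1r -(cov2_reindexZ dM Gam (reindexing_swap_two (k := 2)) der_opp1) //.
by apply: size4_ind => *; rewrite mulN1r; exact: Riem_anti12.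
Qed.

Lemma cov2_Riem_pair m m' i j k l :
  cov2 Riem [:: m; m'; k; l; i; j] = cov2 Riem [:: m; m'; i; j; k; l].
Proof.
rewrite -[RHS]mul1r.
rewrite -(cov2_reindexZ dM Gam reindexing_swap_pairs (der1 dM)) //.
by apply: size4_ind => *; rewrite mul1r; exact: Riem_pair.
Qed.

Lemma cov2_Riem_anti34 m m' i j k l :
  cov2 Riem [:: m; m'; i; j; l; k] = - cov2 Riem [:: m; m'; i; j; k; l].
Proof. by rewrite cov2_Riem_pair cov2_Riem_anti12 cov2_Riem_pair. Qed.

Lemma cov2_sym T : (forall i j, T [:: i; j] = T [:: j; i]) ->
  forall m m' i j, cov2 T [:: m; m'; i; j] = cov2 T [:: m; m'; j; i].
Proof.
move=> Ts m m' i j; rewrite -[RHS]mul1r.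
rewrite -(cov2_reindexZ dM Gam (reindexing_swap_two (k := 0)) (der1 dM)) //.
by apply: size2_ind => *; rewrite mul1r; exact: Ts.
Qed.

Lemma cov2_Riem_bianchi2 p m i j k l :
  cov2 Riem [:: p; m; i; j; k; l] + cov2 Riem [:: p; i; j; m; k; l]
  + cov2 Riem [:: p; j; m; i; k; l] = 0.
Proof.
have r3 := reindexing_rot_three (A := A) (n := n) (k := 2).
have e1 := cov_reindex d Gam (cov Riem) p (I := [:: m; i; j; k; l]) r3 erefl.
have e2 := cov_reindex d Gam (fun I => cov Riem (rot_three I)) p
  (I := [:: m; i; j; k; l]) r3 erefl.
have e3 := cov_reindex d Gam (cov Riem) p (I := [:: i; j; m; k; l]) r3 erefl.
rewrite [rot_three _]/= in e1; rewrite [X in _ :: X]/= in e2.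
rewrite [X in _ = cov _ (_ :: X)]/= in e3.
rewrite -e1 -e3 -e2 -!covD (eq_cov _ _ (U := fun=> 0)).
  by rewrite /cov_deriv raddf0 act0 subrr.
by move=> I [sI]; move: I sI; apply: size5_ind => *; exact: Riem_bianchi2.
Qed.

Definition Ricc I : A :=
  if I is [:: i; k] then tr (fun j l => Riem [:: i; j; k; l]) else 0.

Lemma Ricc_sym i k : Ricc [:: i; k] = Ricc [:: k; i].
Proof. by rewrite [RHS]/Ricc -trC; apply: eq_tr => p q; exact: Riem_pair. Qed.

Lemma cov2_Ricc m m' i k : cov2 Ricc [:: m; m'; i; k] =
  tr (fun p q => cov2 Riem [:: m; m'; i; p; k; q]).
Proof.
pose T I := Riem (interleave I).
transitivity (cov2 (fun I => tr (fun p q => T [:: p, q & I])) [:: m; m'; i; k]).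
  by apply: eq_cov => I [sI]; apply: eq_cov => -[|? [|? [|? ?]]] //=; rewrite sI.
rewrite cov2_tr; apply: eq_tr => p q.
have := cov2_reindex d Gam Riem m m' (I := [:: p; q; i; k])
  (reindexing_interleave (A := A)) erefl.
by rewrite [interleave _]/=.
Qed.

(** Contracted second Bianchi identity, one derivative later: the divergence of
    the curvature is an antisymmetrised derivative of Ric. *)
Lemma tr_cov2_Riem i j k l :
  tr (fun p q => cov2 Riem [:: i; p; q; j; k; l]) =
  cov2 Ricc [:: i; k; l; j] - cov2 Ricc [:: i; l; k; j].
Proof.
rewrite !cov2_Ricc -trB; apply: eq_tr => p q.
rewrite -cov2_Riem_pair; have := cov2_Riem_bianchi2 i p k l q j.
rewrite (cov2_Riem_anti34 i k l p j q) (cov2_Riem_anti12 i l k p).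
by rewrite (cov2_Riem_anti34 i l k p j q) => e; apply: (eq_add0 e); ring.
Qed.

(** All quadratic curvature terms are values of this bilinear form; its symmetries
    [quadC] and [quad_tr] are the symmetries of the tensor B_ijkl. *)
Definition quad f h : A := \sum_p \sum_q \sum_r \sum_s
  gi p r * gi q s * f p q * h r s.

Lemma eq_quad f f' h h' : (forall p q, f p q = f' p q) ->
  (forall p q, h p q = h' p q) -> quad f h = quad f' h'.
Proof. by move=> ff' hh'; do 4!(apply: eq_bigr => ? _); rewrite ff' hh'. Qed.

Lemma quadE f h : quad f h = tr (fun p r => tr (fun q s => f p q * h r s)).
Proof.
rewrite /tr /quad; apply: eq_bigr => p _; rewrite exchange_big.
apply: eq_bigr => q _; rewrite mulr_sumr; apply: eq_bigr => r _.
by rewrite mulr_sumr; apply: eq_bigr => s _; ring.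
Qed.

Lemma quadNr f h : quad f (fun p q => - h p q) = - quad f h.
Proof.
rewrite !quadE -trN; apply: eq_tr => p q; rewrite -trN; apply: eq_tr => r s; ring.
Qed.

Lemma quadBr f h h' :
  quad f (fun p q => h p q - h' p q) = quad f h - quad f h'.
Proof.
rewrite !quadE -trB; apply: eq_tr => p q; rewrite -trB; apply: eq_tr => r s; ring.
Qed.

Lemma quadC f h : quad f h = quad h f.
Proof.
rewrite !quadE -trC; apply: eq_tr => p q; rewrite -trC; apply: eq_tr => r s; ring.
Qed.

Lemma quad_tr f h : quad (fun p q => f q p) (fun p q => h q p) = quad f h.
Proof.
rewrite /quad exchange_big; apply: eq_bigr => p _; apply: eq_bigr => q _.
by rewrite exchange_big; do 2!(apply: eq_bigr => ? _); ring.
Qed.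

Lemma quad_raise f h :
  tr (fun p q => \sum_r (\sum_s gi r s * f p s) * h q r) = quad f h.
Proof.
rewrite quadE; apply: eq_tr => p q; rewrite /tr [RHS]exchange_big.
apply: eq_bigr => r _; rewrite mulr_suml; apply: eq_bigr => s _.
by rewrite (gisym s r) mulrA.
Qed.

Definition RR I : A :=
  if I is [:: i; j; k; l] then
    quad (fun p q => Riem [:: p; i; q; j]) (fun r s => Riem [:: r; k; s; l])
  else 0.

Lemma RR_swap i j k l : RR [:: j; i; l; k] = RR [:: i; j; k; l].
Proof.
rewrite /RR -quad_tr; apply: eq_quad => p q; exact: Riem_pair.
Qed.

Lemma RR_pair i j k l : RR [:: k; l; i; j] = RR [:: i; j; k; l].
Proof. exact: quadC. Qed.

Lemma tr_curv r i :
  tr (fun p q => curv r p i q) = - \sum_s gi r s * Ricc [:: s; i].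
Proof.
transitivity (\sum_s tr (fun p q => Riem [:: p; i; s; q] * gi r s)).
  rewrite -tr_sum; apply: eq_tr => p q; rewrite curv_raise.
  by apply: eq_bigr => s _; rewrite mulrC.
rewrite -sumrN; apply: eq_bigr => s _; rewrite trZr mulrC -mulrN; congr (_ * _).
by rewrite Ricc_sym /Ricc -trN; apply: eq_tr => p q; exact: Riem_anti12.
Qed.

(** The commutator of D_p and D_i acts on the four slots of R_qjkl.  After
    contraction in p and q the first slot gives the Ricci term, the third and
    fourth slots are terms of B directly, and the second one becomes a difference
    of two by the first Bianchi identity R_pqkl = R_pkql - R_plqk. *)
Lemma tr_act_Riem i j k l :
  tr (fun p q => act (fun r s => curv r p i s) Riem [:: q; j; k; l]) =
  - tr (fun p q => Riem [:: p; j; k; l] * Ricc [:: q; i])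
  + (RR [:: i; j; k; l] - RR [:: i; j; l; k])
  + RR [:: i; k; j; l] - RR [:: i; l; j; k].
Proof.
rewrite [act]lock.
transitivity (tr (fun p q => \sum_r curv r p i q * Riem [:: r; j; k; l])
  + tr (fun p q => \sum_r curv r p i j * Riem [:: q; r; k; l])
  + tr (fun p q => \sum_r curv r p i k * Riem [:: q; j; r; l])
  + tr (fun p q => \sum_r curv r p i l * Riem [:: q; j; k; r])).
  rewrite -!trD; apply: eq_tr => p q; rewrite -lock [LHS]/= addr0; ring.
have E x (h : 'I_n -> 'I_n -> A) : tr (fun p q => \sum_r curv r p i x * h q r) =
    quad (fun p s => Riem [:: p; i; s; x]) h.
  rewrite -quad_raise; apply: eq_tr => p q; apply: eq_bigr => r _.
  by rewrite curv_raise.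
rewrite (E j (fun q r => Riem [:: q; r; k; l])).
rewrite (E k (fun q r => Riem [:: q; j; r; l])).
rewrite (E l (fun q r => Riem [:: q; j; k; r])) /RR.
congr (_ + _ + _ + _).
- rewrite tr_sum.
  under eq_bigr do rewrite trZr tr_curv mulNr.
  rewrite sumrN /tr; congr (- _); apply: eq_bigr => r _.
  by rewrite mulr_suml; apply: eq_bigr => q _; ring.
- rewrite -quadBr; apply: eq_quad => // p q.
  have := Riem_bianchi1 p q k l. rewrite (Riem_pair k p q l).
  rewrite (Riem_anti12 p k q l) (Riem_anti12 p l k q) (Riem_anti34 p l q k) => e.
  by apply: (eq_add0 e); ring.
- by rewrite -quadNr; apply: eq_quad => // p q; rewrite Riem_anti34.
Qed.

Lemma cov2_Riem_comm p i q j k l :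
  cov2 Riem [:: p; i; q; j; k; l] =
  cov2 Riem [:: i; p; q; j; k; l]
  - act (fun r s => curv r p i s) Riem [:: q; j; k; l].
Proof.
have /eqP := ricci_identity dM dC Gam_sym p i Riem [:: q; j; k; l].
by rewrite subr_eq addrC => /eqP.
Qed.

(** Hamilton's identity for the Laplacian of the curvature of any metric. *)
Lemma laplacian_Riem i j k l :
  tr (fun p q => cov2 Riem [:: p; q; i; j; k; l]) =
  cov2 Ricc [:: i; k; l; j] - cov2 Ricc [:: i; l; k; j]
  - cov2 Ricc [:: j; k; l; i] + cov2 Ricc [:: j; l; k; i]
  - (1 + 1) * (RR [:: i; j; k; l] - RR [:: i; j; l; k]
               - RR [:: i; l; j; k] + RR [:: i; k; j; l])
  + tr (fun p q => Riem [:: p; j; k; l] * Ricc [:: q; i])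
  + tr (fun p q => Riem [:: i; p; k; l] * Ricc [:: q; j]).
Proof.
transitivity (tr (fun p q => cov2 Riem [:: p; i; q; j; k; l])
  - tr (fun p q => cov2 Riem [:: p; j; q; i; k; l])).
  rewrite -trB; apply: eq_tr => p q.
  have e := cov2_Riem_bianchi2 p q i j k l.
  rewrite (cov2_Riem_anti12 p i q j k l) in e.
  by apply: (eq_add0 e); ring.
have E a b : tr (fun p q => cov2 Riem [:: p; a; q; b; k; l]) =
    tr (fun p q => cov2 Riem [:: a; p; q; b; k; l])
    - tr (fun p q => act (fun r s => curv r p a s) Riem [:: q; b; k; l]).
  by rewrite -trB; apply: eq_tr => p q; exact: cov2_Riem_comm.
rewrite !E !tr_act_Riem !tr_cov2_Riem.
have -> : tr (fun p q => Riem [:: p; i; k; l] * Ricc [:: q; j]) =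
  - tr (fun p q => Riem [:: i; p; k; l] * Ricc [:: q; j]).
  by rewrite -trN; apply: eq_tr => p q; rewrite Riem_anti12 mulNr.
rewrite (RR_swap i j l k) (RR_swap i j k l) (RR_pair i l j k) (RR_pair i k j l).
ring.
Qed.

(** * Variation of the curvature with the metric *)

Local Notation h := (fun I => d None (g I)).

(** dGam_low [:: k; j; l] is the time derivative of Gamma^p_jl lowered with
    g_kp; the permutations put the index k last or the index l first. *)
Definition dGam_low I : A :=
  half * (cov h (rot_three I) + cov h (reverse_three I) - cov h I).

(** In the time derivative of g_kp Gamma^p_jl, the terms in which the connection
    acts on h combine into h_kp Gamma^p_jl, which is what differentiating the
    factor g_kp contributes. *)
Lemma dGam_lowP k j l :
  \sum_p g [:: k; p] * d None (Gam p j l) = dGam_low [:: k; j; l].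
Proof.
have := congr1 (d None) (Gam_lower k j l); rewrite raddf_sum.
under eq_bigr do rewrite dM.
rewrite big_split /= dM der_half mul0r add0r raddfB raddfD !(dC None).
rewrite /dGam_low /=.
have X : \sum_p d None (g [:: k; p]) * Gam p j l =
    \sum_p Gam p j l * d None (g [:: p; k]).
  by apply: eq_bigr => p _; rewrite mulrC gsym.
have Y : \sum_p Gam p l j * d None (g [:: p; k]) =
    \sum_p Gam p j l * d None (g [:: p; k]).
  by apply: eq_bigr => p _; rewrite Gam_sym.
have Z : \sum_p Gam p k j * d None (g [:: p; l]) =
    \sum_p Gam p j k * d None (g [:: l; p]).
  by apply: eq_bigr => p _; rewrite Gam_sym gsym.
have W : \sum_p Gam p k l * d None (g [:: j; p]) =
    \sum_p Gam p l k * d None (g [:: j; p]).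
  by apply: eq_bigr => p _; rewrite Gam_sym.
rewrite X Y Z W; set U := \sum_p Gam p j l * _ => /eqP; rewrite eq_sym addrC -subr_eq.
move=> /eqP <-; rewrite -{1}[U]mul1r -halfP; ring.
Qed.

Lemma cov_dGam_low i k j l : cov dGam_low [:: i; k; j; l] =
  half * (cov2 h [:: i; j; l; k] + cov2 h [:: i; l; j; k] - cov2 h [:: i; k; j; l]).
Proof.
rewrite /dGam_low covZ; [|exact: dM|exact: der_half].
rewrite covB covD; congr (_ * (_ + _ - _)).
  have := cov_reindex d Gam (cov h) i (I := [:: k; j; l])
    (reindexing_rot_three (A := A) (k := 0)) erefl.
  by rewrite [rot_three _]/=.
have := cov_reindex d Gam (cov h) i (I := [:: k; j; l])
  (reindexing_reverse_three (A := A)) erefl.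
by rewrite [reverse_three _]/=.
Qed.

(** The curvature is d Gamma + Gamma ^ Gamma, so its variation is the
    antisymmetrised covariant derivative of the variation of Gamma, which is a
    tensor; lowering the index passes through D by [cov_lower]. *)
Lemma d_curv i j k l : \sum_p g [:: k; p] * d None (curv p i j l) =
  cov dGam_low [:: i; k; j; l] - cov dGam_low [:: j; k; i; l].
Proof.
pose V p J := if J is [:: j; l] then d None (Gam p j l) else 0.
pose T J := if J is k :: J' then \sum_p g [:: k; p] * V p J' else 0.
have E m a b : cov dGam_low [:: m; k; a; b] = \sum_p g [:: k; p] *
    (d (Some m) (V p [:: a; b]) + \sum_q Gam p m q * V q [:: a; b]
     - act (fun p l => Gam p m l) (V p) [:: a; b]).
  rewrite -(cov_lower dM (g := fun i j => g [:: i; j]) (T := T)) //.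
    apply: eq_cov => J [sJ]; move: J sJ; apply: size3_ind => *.
    by rewrite -dGam_lowP.
  exact: metric_compat.
rewrite !E -sumrB; apply: eq_bigr => p _; rewrite -mulrBr; congr (_ * _).
rewrite /curv_up raddfD raddfB !(dC None) raddf_sum /=.
have -> : \sum_q d None (Gam p i q * Gam q j l - Gam p j q * Gam q i l) =
  \sum_q Gam p i q * d None (Gam q j l) + \sum_q Gam q j l * d None (Gam p i q)
  - (\sum_q Gam p j q * d None (Gam q i l) + \sum_q Gam q i l * d None (Gam p j q)).
  rewrite -!big_split -sumrB; apply: eq_bigr => q _ /=.
  by rewrite raddfB !dM; ring.
have -> : \sum_q Gam q j i * d None (Gam p q l) =
    \sum_q Gam q i j * d None (Gam p q l).
  by apply: eq_bigr => q _; rewrite Gam_sym.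
ring.
Qed.

(** The antisymmetrised second derivatives of h in [d_curv] are replaced by
    curvature terms; half of what g_kp contributes to the time derivative cancels
    against them. *)
Theorem d_Riem i j k l : d None (Riem [:: i; j; k; l]) =
  half * (cov2 h [:: i; l; k; j] - cov2 h [:: i; k; j; l]
          - cov2 h [:: j; l; k; i] + cov2 h [:: j; k; i; l])
  + half * tr (fun m p => h [:: k; m] * Riem [:: i; j; p; l]
                        + h [:: m; l] * Riem [:: i; j; k; p]).
Proof.
have hs a b : h [:: a; b] = h [:: b; a] by rewrite gsym.
have -> : d None (Riem [:: i; j; k; l]) = \sum_p curv p i j l * h [:: k; p]
    + (cov dGam_low [:: i; k; j; l] - cov dGam_low [:: j; k; i; l]).
  rewrite -d_curv -big_split raddf_sum; apply: eq_bigr => p _.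
  by rewrite dM mulrC.
rewrite !cov_dGam_low.
have /eqP := ricci_identity dM dC Gam_sym i j h [:: l; k].
rewrite subr_eq => /eqP ->.
rewrite [act]lock (cov2_sym (T := h) hs i l k j) (cov2_sym (T := h) hs j l k i) -lock.
have R a b : \sum_p curv p i j a * h [:: b; p] =
    tr (fun m p => h [:: b; m] * Riem [:: i; j; p; a]).
  rewrite /tr; apply: eq_bigr => m _; rewrite curv_raise mulr_suml.
  by apply: eq_bigr => p _; ring.
have -> : act (fun p l => curv p i j l) h [:: l; k] =
    \sum_p curv p i j l * h [:: k; p] + \sum_p curv p i j k * h [:: l; p].
  rewrite [LHS]/= addr0; congr (_ + _); apply: eq_bigr => p _.
  by rewrite gsym.
rewrite !R trD.
have -> : tr (fun m p => h [:: m; l] * Riem [:: i; j; k; p]) =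
    - tr (fun m p => h [:: l; m] * Riem [:: i; j; p; k]).
  by rewrite -trN; apply: eq_tr => m p; rewrite Riem_anti34 hs; ring.
set X := tr _; rewrite -{1}[X]mul1r -halfP; ring.
Qed.

(** F_i^p F_jp. *)
Definition two_form_square (F : seq 'I_n -> A) I : A :=
  if I is [:: i; j] then \sum_p \sum_q gi p q * F [:: i; q] * F [:: j; p] else 0.

Lemma two_form_square_sym F i j :
  two_form_square F [:: i; j] = two_form_square F [:: j; i].
Proof.
rewrite /two_form_square [LHS]exchange_big.
apply: eq_bigr => p _; apply: eq_bigr => q _.
by rewrite (gisym q p); ring.
Qed.

(** H_ipq H_j^pq. *)
Definition three_form_square (H : seq 'I_n -> A) I : A :=
  if I is [:: i; j] then
    quad (fun p q => H [:: i; p; q]) (fun r s => H [:: j; r; s])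
  else 0.

Lemma three_form_square_sym H i j :
  three_form_square H [:: i; j] = three_form_square H [:: j; i].
Proof. exact: quadC. Qed.

Definition ext1 (B : seq 'I_n -> A) I : A :=
  if I is [:: i; j] then d (Some i) (B [:: j]) - d (Some j) (B [:: i]) else 0.

Definition ext2 (B : seq 'I_n -> A) I : A :=
  if I is [:: i; j; k] then d (Some i) (B [:: j; k])
    + d (Some j) (B [:: k; i]) + d (Some k) (B [:: i; j])
  else 0.

Section Flow.
Variables (HH FF : seq 'I_n -> A) (quarter : A).
Hypothesis HHsym : forall i j, HH [:: i; j] = HH [:: j; i].
Hypothesis FFsym : forall i j, FF [:: i; j] = FF [:: j; i].
Hypothesis quarterP : quarter = half * half.
Hypothesis flow : forall i j, d None (g [:: i; j]) =
  - (1 + 1) * (Ricc [:: i; j] - quarter * HH [:: i; j] - FF [:: i; j]).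

Theorem curvature_evolution i j k l : d None (Riem [:: i; j; k; l]) =
  tr (fun p q => cov2 Riem [:: p; q; i; j; k; l])
  + (1 + 1) * (RR [:: i; j; k; l] - RR [:: i; j; l; k]
         - RR [:: i; l; j; k] + RR [:: i; k; j; l])
  - tr (fun p q => Riem [:: p; j; k; l] * Ricc [:: q; i]
         + Riem [:: i; p; k; l] * Ricc [:: q; j]
         + Riem [:: i; j; p; l] * Ricc [:: q; k]
         + Riem [:: i; j; k; p] * Ricc [:: q; l])
  + quarter * (cov2 HH [:: i; l; k; j] - cov2 HH [:: i; k; j; l]
            - cov2 HH [:: j; l; k; i] + cov2 HH [:: j; k; i; l])
  + quarter * tr (fun m p => HH [:: k; m] * Riem [:: i; j; p; l]
         + HH [:: m; l] * Riem [:: i; j; k; p])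
  + (cov2 FF [:: i; l; k; j] - cov2 FF [:: i; k; j; l]
     - cov2 FF [:: j; l; k; i] + cov2 FF [:: j; k; i; l])
  + tr (fun m p => FF [:: k; m] * Riem [:: i; j; p; l]
         + FF [:: m; l] * Riem [:: i; j; k; p]).
Proof.
have der_two m : d m (- (1 + 1)) = 0.
  by rewrite raddfN raddfD (der1 dM) addr0 oppr0.
have der_quarter m : d m (- quarter) = 0.
  by rewrite raddfN quarterP dM !der_half mulr0 mul0r addr0 oppr0.
have cov2_h m m' a b : cov2 h [:: m; m'; a; b] =
    - (1 + 1) * (cov2 Ricc [:: m; m'; a; b] - quarter * cov2 HH [:: m; m'; a; b]
                 - cov2 FF [:: m; m'; a; b]).
  transitivity (cov2 (fun I => - (1 + 1) *
      (Ricc I + (- quarter * HH I + (- 1) * FF I))) [:: m; m'; a; b]).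
    apply: eq_cov => J [sJ]; apply: eq_cov => J' [sJ'].
    have {sJ sJ'} : size J' = 2%N by congruence.
    move: J'; apply: size2_ind => x y; rewrite flow; ring.
  rewrite cov2Z // cov2D cov2D !cov2Z //; [ring|exact: der_opp1].
rewrite laplacian_Riem d_Riem !cov2_h !trD.
have trh (v : 'I_n -> A) b : tr (fun m p => h [:: b; m] * v p) =
    - (1 + 1) * (tr (fun p m => v p * Ricc [:: m; b])
      - quarter * tr (fun m p => HH [:: b; m] * v p)
      - tr (fun m p => FF [:: b; m] * v p)).
  rewrite -(trC (fun p m => v p * _)) -trZl -!trB -trZl.
  by apply: eq_tr => p q; rewrite flow Ricc_sym; ring.
rewrite (trh (fun p => Riem [:: i; j; p; l])).
have swapl (T : seq 'I_n -> A) (f : 'I_n -> A) : (forall i j, T [:: i; j] = T [:: j; i]) ->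
    tr (fun m p => T [:: m; l] * f p) = tr (fun m p => T [:: l; m] * f p).
  by move=> Ts; apply: eq_tr => m p; rewrite Ts.
rewrite (swapl h (fun p => Riem [:: i; j; k; p])); last by move=> ? ?; rewrite gsym.
rewrite (trh (fun p => Riem [:: i; j; k; p])).
rewrite (swapl HH (fun p => Riem [:: i; j; k; p])) //.
rewrite (swapl FF (fun p => Riem [:: i; j; k; p])) //.
rewrite (cov2_sym Ricc_sym i l k j) (cov2_sym Ricc_sym i k j l).
rewrite (cov2_sym Ricc_sym j l k i) (cov2_sym Ricc_sym j k i l).
have halfK x : half * (- (1 + 1) * x) = - x.
  by rewrite mulrA -[half * _]opprK -mulrN opprK mulrDr mulr1 halfP mulN1r.
rewrite -!mulrBr -!mulrDr !halfK; ring.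
Qed.

End Flow.

End Metric.

(** * One-sided derivatives in time *)
Section TimeDerivative.
Context {R : realType}.
Implicit Types (J : set R) (f g : R -> R) (t v : R).

(** The epsilon form makes one-sided and two-sided derivatives comparable, since
    both are about the same difference quotient. *)
Lemma is_tderivP J f t v : is_tderiv J f t v <->
  forall e, 0 < e -> exists2 r, 0 < r & forall s, J s -> s != t ->
    `|s - t| < r -> `|v - diff_quotient f t s| <= e.
Proof.
rewrite /is_tderiv; split.
  move=> /cvgrPdist_le cf e e0; have := cf e e0.
  rewrite near_withinE near_withinE => /nbhs_normP[r /= r0 rP].
  exists r => // s Js st str; apply: rP => //=.
  by rewrite distrC.
move=> H; apply/cvgrPdist_le => e e0; have [r r0 rP] := H e e0.
rewrite near_withinE near_withinE; apply/nbhs_normP; exists r => //= s /= sr st Js.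
by apply: rP => //; rewrite distrC.
Qed.

Lemma is_deriveP f t v : is_derive t 1 f v <->
  forall e, 0 < e -> exists2 r, 0 < r & forall s, s != t ->
    `|s - t| < r -> `|v - diff_quotient f t s| <= e.
Proof.
have E h : h^-1 *: (f (h *: (1 : R) + t) - f t) = diff_quotient f t (h + t).
  by rewrite /diff_quotient addrK [h *: 1]mulr1 mulrC.
split.
  move=> [df <-] e e0.
  have /cvgrPdist_le/(_ e e0) : (fun h => h^-1 *: (f (h *: (1 : R) + t) - f t)) @ 0^' --> 'D_1 f t.
    exact: df.
  rewrite near_withinE => /nbhs_normP[r /= r0 rP]; exists r => // s st sr.
  have := rP (s - t); rewrite /= E subrK; apply; last by rewrite subr_eq0.
  by rewrite sub0r normrN.
move=> H.
suff C : (fun h => h^-1 *: (f (h *: (1 : R) + t) - f t)) @ 0^' --> v.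
  apply: DeriveDef; first by apply/cvg_ex; exists v.
  exact: cvg_lim C.
apply/cvgrPdist_le => e e0; have [r r0 rP] := H e e0.
rewrite near_withinE; apply/nbhs_normP; exists r => //= h /= hr h0.
rewrite E; apply: rP; last by rewrite addrK; move: hr; rewrite sub0r normrN.
by rewrite -subr_eq0 addrK.
Qed.

Lemma is_derive_tderiv J f t v : is_derive t 1 f v -> is_tderiv J f t v.
Proof.
move=> /is_deriveP H; apply/is_tderivP => e e0; have [r r0 rP] := H e e0.
by exists r => // s _; apply: rP.
Qed.

Lemma is_tderiv_derive J f t v : nbhs t J -> is_tderiv J f t v -> is_derive t 1 f v.
Proof.
move=> /nbhs_normP[r' /= r'0 Jr] /is_tderivP H; apply/is_deriveP => e e0.
have [r r0 rP] := H e e0; exists (Num.min r r'); first by rewrite lt_min r0.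
move=> s st; rewrite lt_min => /andP[sr sr']; apply: rP => //.
by apply: Jr; rewrite /= distrC.
Qed.

Lemma eq_is_tderiv J f g t v : J t -> (forall s, J s -> f s = g s) ->
  is_tderiv J f t v -> is_tderiv J g t v.
Proof.
move=> Jt fg /is_tderivP H; apply/is_tderivP => e e0; have [r r0 rP] := H e e0.
exists r => // s Js st sr; have := rP s Js st sr.
by rewrite /diff_quotient !fg.
Qed.

(** A point of a nondegenerate interval is a limit of other points of it, so that
    one-sided derivatives are unique.  The point s lies on the segment from t to
    another point u of J, at distance less than r from t. *)
Lemma within_dnbhs_proper J t : is_interval J ->
  (exists t0 t1, [/\ J t0, J t1 & t0 < t1]) -> J t ->
  ProperFilter (within J t^').
Proof.
move=> iJ [t0 [t1 [Jt0 Jt1 t01]]] Jt; split; last first.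
  by apply: within_filter; exact: dnbhs_filter.
have [u Ju ut] : exists2 u, J u & u != t.
  case: (eqVneq t0 t) => [tt|]; last by exists t0.
  by exists t1 => //; rewrite -tt gt_eqF.
rewrite /within /= => /nbhs_normP[r /= r0 rP].
have a0 : 0 < `|u - t| by rewrite normr_gt0 subr_eq0.
pose c := Num.min 1 (r / 2 / `|u - t|).
have c0 : 0 < c by rewrite lt_min ltr01 /= !divr_gt0.
have c1 : c <= 1 by rewrite ge_min lexx.
have cr : c * `|u - t| < r.
  apply: (@le_lt_trans _ _ (r / 2)); last by rewrite ltr_pdivrMr // ltr_pMr // ltr1n.
  by rewrite -ler_pdivlMr // ge_min lexx orbT.
pose s := t + c * (u - t).
apply: (rP s).
- by rewrite /= /s opprD addNKr normrN normrM (gtr0_norm c0).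
- by rewrite /s -subr_eq0 addrAC subrr add0r mulf_neq0 ?(gt_eqF c0) ?subr_eq0.
- rewrite /s; have [tu|ut'|tu] := ltgtP t u.
  + apply: (iJ t u) => //; apply/andP; split; nra.
  + apply: (iJ u t) => //; apply/andP; split; nra.
  + by rewrite tu eqxx in ut.
Qed.

Section Rules.
Variables (J : set R) (t : R).
Hypotheses (iJ : is_interval J) (J2 : exists t0 t1, [/\ J t0, J t1 & t0 < t1]).
Hypothesis Jt : J t.

Lemma is_tderiv_tderiv f v : is_tderiv J f t v -> tderiv J f t = v.
Proof.
have := within_dnbhs_proper iJ J2 Jt => ? /cvg_lim; apply.
exact: Rhausdorff.
Qed.

Lemma is_tderiv_cst (c : R) : is_tderiv J (fun=> c) t 0.
Proof.
apply/is_tderivP => e e0; exists 1 => // s _ _ _.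
by rewrite /diff_quotient subrr mul0r subrr normr0 ltW.
Qed.

Lemma is_tderivD f g u v : is_tderiv J f t u -> is_tderiv J g t v ->
  is_tderiv J (fun s => f s + g s) t (u + v).
Proof.
have := within_dnbhs_proper iJ J2 Jt => ? fu gv.
apply: cvg_trans (cvgD fu gv); apply: near_eq_cvg; apply: nearW => s.
rewrite -[LHS]/(diff_quotient f t s + diff_quotient g t s) /diff_quotient; ring.
Qed.

Lemma is_tderiv_continuous f u : is_tderiv J f t u ->
  f s @[s --> within J t^'] --> f t.
Proof.
have := within_dnbhs_proper iJ J2 Jt => ? fu.
have idt : (fun s => s - t) s @[s --> within J t^'] --> (0 : R).
  rewrite -(subrr t); apply: cvgB; last exact: cvg_cst.
  apply: cvg_within_filter; apply: cvg_within_filter; exact: cvg_id.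
have H : diff_quotient f t s * (s - t) + f t @[s --> within J t^'] --> u * 0 + f t.
  by apply: cvgD; [exact: cvgM|exact: cvg_cst].
rewrite mulr0 add0r in H; apply: cvg_trans H; apply: near_eq_cvg; rewrite near_withinE near_withinE.
near=> s => st _ /=; rewrite /diff_quotient /= divfK ?subrK //.
by rewrite subr_eq0.
Unshelve. all: by end_near. Qed.

Lemma is_tderivM f g u v : is_tderiv J f t u -> is_tderiv J g t v ->
  is_tderiv J (fun s => f s * g s) t (u * g t + f t * v).
Proof.
have := within_dnbhs_proper iJ J2 Jt => ? fu gv.
apply: cvg_trans (cvgD (cvgM fu (is_tderiv_continuous gv))
  (cvgM (cvg_cst (f t)) gv)).
apply: near_eq_cvg; apply: nearW => s.
rewrite -[LHS]/(diff_quotient f t s * g s + f t * diff_quotient g t s).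
by rewrite /diff_quotient; ring.
Qed.

Lemma is_tderivV f u : (forall s, J s -> f s != 0) -> is_tderiv J f t u ->
  is_tderiv J (fun s => (f s)^-1) t (- u * (f t)^-1 * (f t)^-1).
Proof.
move=> f0; have := within_dnbhs_proper iJ J2 Jt => ? fu.
have H : - diff_quotient f t s * (f s)^-1 * (f t)^-1 @[s --> within J t^'] -->
    - u * (f t)^-1 * (f t)^-1.
  apply: cvgM; last exact: cvg_cst.
  apply: cvgM; first exact: cvgN.
  apply: cvgV; [exact: f0|exact: is_tderiv_continuous fu].
apply: cvg_trans H; apply: near_eq_cvg; rewrite near_withinE near_withinE.
near=> s => st Js /=; rewrite /diff_quotient /=.
have := f0 _ Jt; have := f0 _ Js; have : s - t != 0 by rewrite subr_eq0.
by move=> *; field; apply/and3P.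
Unshelve. all: by end_near. Qed.

End Rules.
End TimeDerivative.

(** * One-sided derivatives and continuous mixed derivatives *)

Section Schwarz.
Context {R : realType}.
Implicit Types (J : set R) (f : R -> R).

(** At interior points of the segment one-sided derivatives are genuine ones, so
    the classical mean value theorem applies.  The endpoints come in either
    order. *)
Lemma tderiv_mvt J f (df : R -> R) a b : is_interval J ->
  (exists t0 t1, [/\ J t0, J t1 & t0 < t1]) ->
  (forall s, J s -> is_tderiv J f s (df s)) -> J a -> J b ->
  exists c, [/\ J c, `|c - a| <= `|b - a| & f b - f a = df c * (b - a)].
Proof.
move=> iJ J2 dfP.
have main x y : J x -> J y -> x < y ->
    exists2 c, x < c < y & f y - f x = df c * (y - x).
  move=> Jx Jy xy.
  have Jxy z : x <= z <= y -> J z by apply: iJ.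
  have [z||c] := MVT (f := f) (df := df) xy.
  - rewrite in_itv /= => /andP[xz zy].
    apply: (@is_tderiv_derive _ J); last by apply: dfP; apply: Jxy; rewrite !ltW.
    have : nbhs z `]x, y[%classic.
      by apply: open_nbhs_nbhs; split; [exact: interval_open|rewrite /= in_itv /= xz].
    apply: filterS => w; rewrite /= in_itv /= => /andP[xw wy].
    by apply: Jxy; rewrite !ltW.
  - apply/subspace_continuousP => z; rewrite /= in_itv /= => /Jxy Jz.
    have cz := is_tderiv_continuous iJ J2 Jz (dfP z Jz).
    move=> U Uf.
    have H : nbhs (z : R) [set w | w != z -> J w -> U (f w)] := cz U Uf.
    have {H} : nbhs (z : R) [set w | w \in `[x, y] -> U (f w)].
      apply: filterS H => w /= H; rewrite in_itv /= => /Jxy Jw.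
      have [->|wz] := eqVneq w z; first exact: nbhs_singleton Uf.
      exact: H.
    exact.
  - by rewrite in_itv /= => cxy E; exists c.
move=> Ja Jb; have [ab|ba|->] := ltgtP a b.
- have [c /andP[ac cb] E] := main a b Ja Jb ab; exists c; split=> //.
    by apply: (iJ a b) => //; rewrite !ltW.
  by rewrite !ger0_norm ?subr_ge0 ?(ltW ab) ?(ltW ac) // lerD2r ltW.
- have [c /andP[bc ca] E] := main b a Jb Ja ba; exists c; split=> //.
  + by apply: (iJ b a) => //; rewrite !ltW.
  + by rewrite !ler0_norm ?subr_le0 ?(ltW ba) ?(ltW ca) // lerN2 lerD2r ltW.
  + by rewrite -[LHS]opprB E; ring.
- by exists b; split=> //; rewrite !subrr ?mulr0.
Qed.

(** Schwarz's theorem with a one-sided first variable.  By the mean value theorem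
    in s and then in h, the second difference quotient of F over the rectangle
    with corners (t, 0) and (s, h) is a value of F12 at a point of the rectangle,
    hence close to F12 t 0; letting h tend to 0 turns it into the difference
    quotient of F2. *)
Lemma mixed_tderiv J (t r : R) (F F1 F12 : R -> R -> R) (F2 : R -> R) :
  is_interval J -> (exists t0 t1, [/\ J t0, J t1 & t0 < t1]) -> J t -> 0 < r ->
  (forall s h : R, J s -> `|h| < r -> is_tderiv J (F^~ h) s (F1 s h)) ->
  (forall s h : R, J s -> `|h| < r -> is_derive h 1 (F1 s) (F12 s h)) ->
  (forall e, 0 < e -> exists2 q, 0 < q & forall s h : R, J s -> `|s - t| < q ->
     `|h| < q -> `|F12 t 0 - F12 s h| <= e) ->
  (forall s, J s -> is_derive (0 : R) 1 (F s) (F2 s)) ->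
  is_tderiv J F2 t (F12 t 0).
Proof.
move=> iJ J2 Jt r0 dF1 dF12 cF12 dF2; apply/is_tderivP => e e0.
have [q q0 qP] := cF12 e e0; exists q => // s Js st sq.
pose L := diff_quotient F2 t s.
pose G h := (F s h - F t h) / (s - t).
have dG : is_derive (0 : R) 1 G L.
  have ds := dF2 _ Js; have dt := dF2 _ Jt.
  have -> : G = (s - t)^-1 *: (F s - F t).
    by apply/funext => h; rewrite /G mulrC.
  apply: is_derive_eq.
  by rewrite /L /diff_quotient mulrC.
have GP h : h != 0 -> `|h| < q -> `|h| < r ->
    `|F12 t 0 - diff_quotient G 0 h| <= e.
  move=> h0 hq hr.
  have [|c [Jc ct E]] := tderiv_mvt (f := fun s => F s h - F s 0)
    (df := fun s => F1 s h - F1 s 0) iJ J2 _ Jt Js.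
    move=> s' Js'; have := is_tderivD iJ J2 Js' (dF1 s' h Js' hr)
      (is_tderivM iJ J2 Js' (is_tderiv_cst J s' (-1)) (dF1 s' 0 Js' _)).
    rewrite normr0 mul0r add0r mulN1r => /(_ r0).
    by apply: eq_is_tderiv => // s'' _; rewrite mulN1r.
  pose K := [set h : R | `|h| < r].
  have iK : is_interval K.
    move=> x y; rewrite /K /= !ltr_norml => /andP[? ?] /andP[? ?] z /andP[? ?].
    by rewrite ltr_norml; apply/andP; split; lra.
  have K2 : exists t0 t1 : R, [/\ K t0, K t1 & t0 < t1].
    by exists 0, (r / 2); rewrite /K /= normr0 gtr0_norm ?divr_gt0 //; split; lra.
  have K0 : K 0 by rewrite /K /= normr0.
  have [s' Ks'|c' [Kc' ct' E']] := tderiv_mvt (f := F1 c) (df := F12 c) iK K2 _ K0 (hr : K h).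
    by apply: is_derive_tderiv; exact: dF12.
  have -> : diff_quotient G 0 h = F12 c c'.
    have st0 : s - t != 0 by rewrite subr_eq0.
    have E2 : F s h - F t h - (F s 0 - F t 0) = F12 c c' * h * (s - t).
      by rewrite -[h]subr0 -E' subr0 -E; ring.
    by rewrite /diff_quotient /G subr0 -mulrBl E2 !mulfK.
  apply: qP => //; first exact: le_lt_trans sq.
  by apply: le_lt_trans hq; move: ct'; rewrite !subr0.
apply/ler_addgt0Pl => e' e'0.
have /is_deriveP/(_ e' e'0)[q' q'0 q'P] := dG.
(* the point h = m / 2 is admissible for both estimates A and B below *)
pose m := Num.min q (Num.min r q').
have m0 : 0 < m by rewrite !lt_min q0 r0.
have mq : m <= q by rewrite ge_min lexx.
have mr : m <= r by rewrite !ge_min lexx orbT.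
have mq' : m <= q' by rewrite !ge_min lexx !orbT.
pose h := m / 2.
have h0 : 0 < h by rewrite divr_gt0.
have hm : h < m by rewrite /h; lra.
have nh : `|h| = h by rewrite gtr0_norm.
have A : `|F12 t 0 - diff_quotient G 0 h| <= e.
  by apply: GP; rewrite ?gt_eqF // nh; exact: lt_le_trans hm _.
have B : `|L - diff_quotient G 0 h| <= e'.
  by apply: q'P; rewrite ?gt_eqF // subr0 nh; exact: lt_le_trans hm _.
rewrite -/L -[F12 t 0 - L](subrKA (diff_quotient G 0 h)).
apply: le_trans (ler_normD _ _) _; rewrite addrC lerD //.
by rewrite distrC.
Qed.

End Schwarz.

(** * Smooth functions of time and position *)
(** Space-time domains on which the ring of smooth functions is formed.  Bundling
    the hypotheses lets the ring structure be inferred from the domain. *)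
Record stdom (R : realType) (n : nat) := Stdom {
  times : set R;
  places : set 'rV[R]_n;
  times_interval : is_interval times;
  times_nondegenerate : exists t0 t1, [/\ times t0, times t1 & t0 < t1];
  places_open : open places;
  places_nonempty : places !=set0 }.

Section Smooth.
Context {R : realType} {n : nat} (S : stdom R n).
Local Notation J := (times S).
Local Notation D := (places S).
Local Notation iJ := (@times_interval _ _ S).
Local Notation J2 := (@times_nondegenerate _ _ S).
Implicit Types (f g : R -> 'rV[R]_n -> R) (d : option 'I_n).

(** Relational form of the partial derivatives, which treats the time direction
    and the coordinate directions uniformly and carries differentiability. *)
Definition is_st_partial d f t x v : Prop :=
  if d is Some i then is_derive x 'e_i (f t) v else is_tderiv J (f ^~ x) t v.

Lemma st_derivableP d f t x : st_derivable J d f t x ->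
  is_st_partial d f t x (st_partial J d f t x).
Proof. by case: d => [i|] df //; exact: derivableP. Qed.

Lemma is_st_partial_derivable d f t x v :
  is_st_partial d f t x v -> st_derivable J d f t x.
Proof. by case: d => [i|] /= df; [exact: ex_derive|apply/cvg_ex; exists v]. Qed.

Lemma is_st_partialE d f t x v : J t ->
  is_st_partial d f t x v -> st_partial J d f t x = v.
Proof.
move=> Jt; case: d => [i|] /= df; first exact: derive_val.
exact: (is_tderiv_tderiv iJ J2 Jt df).
Qed.

Lemma nbhs_places x : D x -> nbhs x D.
Proof. by move=> Dx; apply: open_nbhs_nbhs; split=> //; exact: places_open. Qed.

Lemma eq_is_st_partial d f g t x v : J t -> D x ->
  (forall s y, J s -> D y -> f s y = g s y) ->
  is_st_partial d f t x v -> is_st_partial d g t x v.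
Proof.
move=> Jt Dx fg; case: d => [i|] /=; last first.
  by apply: eq_is_tderiv => // s Js; exact: fg.
by apply: near_eq_is_derive; apply: filterS (nbhs_places Dx) => y; exact: fg.
Qed.

Lemma is_st_partial_cst d c t x : is_st_partial d (fun _ _ => c) t x 0.
Proof. by case: d => [i|] /=; [exact: is_derive_cst|exact: is_tderiv_cst]. Qed.

Lemma is_st_partialD d f g t x u v : J t ->
  is_st_partial d f t x u -> is_st_partial d g t x v ->
  is_st_partial d (fun t x => f t x + g t x) t x (u + v).
Proof.
move=> Jt; case: d => [i|] /= fu gv; last exact: (is_tderivD iJ J2 Jt fu gv).
exact: is_deriveD.
Qed.

Lemma is_st_partialM d f g t x u v : J t ->
  is_st_partial d f t x u -> is_st_partial d g t x v ->
  is_st_partial d (fun t x => f t x * g t x) t x (u * g t x + f t x * v).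
Proof.
move=> Jt; case: d => [i|] /= fu gv; last exact: (is_tderivM iJ J2 Jt fu gv).
have H := is_deriveM fu gv; apply: (is_derive_eq H).
by rewrite addrC; congr (_ + _); rewrite -mulr_algl mulrC [_%:A]mulr1.
Qed.

Lemma is_st_partialV d f t x u : J t -> D x ->
  (forall t x, J t -> D x -> f t x != 0) ->
  is_st_partial d f t x u ->
  is_st_partial d (fun t x => (f t x)^-1) t x (- u * (f t x)^-1 * (f t x)^-1).
Proof.
move=> Jt Dx f0; case: d => [i|] /= fu; last first.
  exact: (is_tderivV iJ J2 Jt (fun s Js => f0 s x Js Dx) fu).
have fx0 := f0 _ _ Jt Dx; apply: DeriveDef; first exact: derivableV.
by rewrite deriveV // derive_val expr2 invfM /GRing.scale /=; ring.
Qed.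

Definition st_continuous f := {within J `*` D, continuous (fun p => f p.1 p.2)}.

Lemma eq_st_continuous f g : (forall t x, J t -> D x -> f t x = g t x) ->
  st_continuous f -> st_continuous g.
Proof.
move=> fg; apply: subspace_eq_continuous => -[t x]; rewrite inE => -[/= Jt Dx].
exact: fg.
Qed.

Lemma st_continuous_cst c : st_continuous (fun _ _ => c).
Proof. by move=> p; exact: cst_continuous. Qed.

Lemma st_continuousD f g : st_continuous f -> st_continuous g ->
  st_continuous (fun t x => f t x + g t x).
Proof. by move=> cf cg p; apply: cvgD; [exact: cf|exact: cg]. Qed.

Lemma st_continuousM f g : st_continuous f -> st_continuous g ->
  st_continuous (fun t x => f t x * g t x).
Proof. by move=> cf cg p; apply: cvgM; [exact: cf|exact: cg]. Qed.

Lemma st_continuousV f : (forall t x, J t -> D x -> f t x != 0) ->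
  st_continuous f -> st_continuous (fun t x => (f t x)^-1).
Proof.
move=> f0 /subspace_continuousP cf; apply/subspace_continuousP => -[t x] /= p.
by apply: cvgV; [case: p; exact: f0|exact: (cf (t, x))].
Qed.

(** Finite orders of smoothness, by recursion on the order: closure properties of
    the class of smooth functions become inductions, which the quantification
    over words of derivatives does not offer directly. *)
Fixpoint smooth_upto k f : Prop :=
  st_continuous f /\
  if k is k'.+1 then forall d,
    (forall t x, J t -> D x -> st_derivable J d f t x) /\
    smooth_upto k' (st_partial J d f)
  else True.

Lemma eq_smooth_upto k f g : (forall t x, J t -> D x -> f t x = g t x) ->
  smooth_upto k f -> smooth_upto k g.
Proof.
elim: k f g => [|k IH] f g fg /= [cf df]; split=> //;
  try exact: eq_st_continuous fg cf.
move=> d; have [dfd sf] := df d.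
have dg t x : J t -> D x -> is_st_partial d g t x (st_partial J d f t x).
  move=> Jt Dx; apply: (eq_is_st_partial Jt Dx fg); apply: st_derivableP.
  exact: dfd.
split; first by move=> t x Jt Dx; apply: is_st_partial_derivable (dg t x Jt Dx).
apply: IH sf => t x Jt Dx; apply/esym/is_st_partialE => //; exact: dg.
Qed.

Lemma smooth_uptoS k f : smooth_upto k.+1 f -> smooth_upto k f.
Proof.
elim: k f => [|k IH] f [cf df]; first by split.
by split=> // d; have [dfd sf] := df d; split=> //; exact: IH.
Qed.

(** To be smooth it suffices to have some functions f' d as partial derivatives
    and to have these smooth; in the applications the f' d are given by the
    rules of calculus. *)
Lemma smooth_upto_intro k f (f' : option 'I_n -> R -> 'rV[R]_n -> R) :
  st_continuous f ->
  (forall d t x, J t -> D x -> is_st_partial d f t x (f' d t x)) ->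
  (forall d, smooth_upto k (f' d)) -> smooth_upto k.+1 f.
Proof.
move=> cf df sf'; split=> // d; split.
  by move=> t x Jt Dx; apply: is_st_partial_derivable (df d t x Jt Dx).
apply: eq_smooth_upto (sf' d) => t x Jt Dx; apply/esym/is_st_partialE => //.
exact: df.
Qed.

Lemma smooth_upto_cst k c : smooth_upto k (fun _ _ => c).
Proof.
elim: k c => [|k IH] c; first by split=> //; exact: st_continuous_cst.
apply: (@smooth_upto_intro _ _ (fun _ _ _ => 0)) => //.
  exact: st_continuous_cst.
by move=> *; exact: is_st_partial_cst.
Qed.

Lemma smooth_uptoD k f g : smooth_upto k f -> smooth_upto k g ->
  smooth_upto k (fun t x => f t x + g t x).
Proof.
elim: k f g => [|k IH] f g sf sg.
  by split=> //; apply: st_continuousD; [case: sf|case: sg].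
have [[cf df] [cg dg]] := (sf, sg).
apply: (@smooth_upto_intro _ _
  (fun d t x => st_partial J d f t x + st_partial J d g t x)).
- exact: st_continuousD.
- move=> d t x Jt Dx; apply: is_st_partialD => //; apply: st_derivableP.
    exact: (df d).1.
  exact: (dg d).1.
- by move=> d; apply: IH; [exact: (df d).2|exact: (dg d).2].
Qed.

Lemma smooth_uptoM k f g : smooth_upto k f -> smooth_upto k g ->
  smooth_upto k (fun t x => f t x * g t x).
Proof.
elim: k f g => [|k IH] f g sf sg.
  by split=> //; apply: st_continuousM; [case: sf|case: sg].
have [[cf df] [cg dg]] := (sf, sg).
apply: (@smooth_upto_intro _ _
  (fun d t x => st_partial J d f t x * g t x + f t x * st_partial J d g t x)).
- exact: st_continuousM.
- move=> d t x Jt Dx; apply: is_st_partialM => //; apply: st_derivableP.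
    exact: (df d).1.
  exact: (dg d).1.
- move=> d; apply: smooth_uptoD; apply: IH.
  + exact: (df d).2.
  + exact: smooth_uptoS.
  + exact: smooth_uptoS.
  + exact: (dg d).2.
Qed.

Lemma smooth_uptoV k f : (forall t x, J t -> D x -> f t x != 0) ->
  smooth_upto k f -> smooth_upto k (fun t x => (f t x)^-1).
Proof.
move=> f0; elim: k => [|k IH] sf.
  by split=> //; apply: st_continuousV => //; case: sf.
have [cf df] := sf.
have sV := IH (smooth_uptoS sf).
apply: (@smooth_upto_intro _ _
  (fun d t x => (-1) * st_partial J d f t x * (f t x)^-1 * (f t x)^-1)).
- exact: st_continuousV.
- move=> d t x Jt Dx; rewrite mulN1r; apply: is_st_partialV => //.
  apply: st_derivableP; exact: (df d).1.
- move=> d; do 2!(apply: smooth_uptoM => //).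
  by apply: smooth_uptoM; [exact: smooth_upto_cst|exact: (df d).2].
Qed.

(** The first derivative taken is the last letter of the word w. *)
Lemma smooth_upto_partials w k f :
  smooth_upto (size w + k) f -> smooth_upto k (st_partials J w f).
Proof.
elim/last_ind: w f => [|w d IH] f //.
rewrite size_rcons addSn => -[_ df]; rewrite /st_partials foldr_rcons.
by apply: IH; exact: (df d).2.
Qed.

Lemma st_smoothP f : st_smooth_on J D f <-> forall k, smooth_upto k f.
Proof.
split=> [sf k|sf w].
  elim: k f sf => [|k IH] f sf; first by split=> //; exact: (sf [::]).1.
  split; first exact: (sf [::]).1.
  move=> d; split; first by move=> t x Jt Dx; exact: (sf [::]).2.
  by apply: IH => w; have := sf (rcons w d); rewrite /st_partials foldr_rcons.
have := @smooth_upto_partials w 1 f (sf _) => -[cw dw]; split=> // d t x.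
exact: (dw d).1.
Qed.

Lemma st_smooth_partial d f :
  st_smooth_on J D f -> st_smooth_on J D (st_partial J d f).
Proof.
by move=> sf w; have := sf (rcons w d); rewrite /st_partials foldr_rcons.
Qed.

Lemma st_smooth_is_partial d f t x : st_smooth_on J D f -> J t -> D x ->
  is_st_partial d f t x (st_partial J d f t x).
Proof. by move=> sf Jt Dx; apply: st_derivableP; exact: (sf [::]).2. Qed.

End Smooth.

(** * Commutation of mixed partial derivatives *)
Section MixedPartials.
Context {R : realType} {n : nat} (S : stdom R n).
Local Notation J := (times S).
Local Notation D := (places S).
Local Notation iJ := (@times_interval _ _ S).
Local Notation J2 := (@times_nondegenerate _ _ S).
Implicit Types (f : R -> 'rV[R]_n -> R) (d : option 'I_n) (e : 'rV[R]_n).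

(** Reduces directional derivatives to derivatives of functions of one variable. *)
Lemma is_derive_lineP (F : 'rV[R]_n -> R) (y e : 'rV[R]_n) (h v : R) :
  is_derive (y + h *: e) e F v <-> is_derive h 1 (fun k => F (y + k *: e)) v.
Proof.
have E : (fun k : R => k^-1 *: ((F \o shift (y + h *: e)) (k *: e) - F (y + h *: e))) =
    (fun k : R => k^-1 *: (((fun k => F (y + k *: e)) \o shift h) (k *: (1 : R))
      - F (y + h *: e))).
  apply/funext => k /=; congr (_ *: (F _ - _)).
  by rewrite addrCA scalerDl [k *: (1 : R)]mulr1.
by split=> -[dF <-]; apply: DeriveDef; move: dF; rewrite /derivable /derive E.
Qed.

Lemma plane_nbhs (x : 'rV[R]_n) e e' (B : set 'rV[R]_n) : nbhs x B ->
  exists2 q : R, 0 < q &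
    forall s h : R, `|s| < q -> `|h| < q -> B (x + s *: e + h *: e').
Proof.
move=> /nbhs_normP[r /= r0 rB].
pose c := `|e| + `|e'| + 1.
have c0 : 0 < c by rewrite ltr_wpDl // addr_ge0.
exists (r / 2 / c); first by rewrite !divr_gt0.
move=> s h sq hq; apply: rB => /=.
rewrite opprD opprD addrA addNKr -opprD normrN.
apply: le_lt_trans (ler_normD _ _) _; rewrite !normrZ.
rewrite !ltr_pdivlMr // in sq hq.
have := normr_ge0 e; have := normr_ge0 e'; have := normr_ge0 s; have := normr_ge0 h.
have split_r : r = r / 2 + r / 2 by rewrite -splitr.
rewrite /c in sq hq; rewrite split_r.
move: `|e| `|e'| `|s| `|h| sq hq => a b u w sq hq w0 u0 b0 a0.
apply: ltrD; nra.
Qed.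

Lemma st_continuous_near f t x : st_continuous S f -> J t -> D x ->
  forall eps, 0 < eps -> exists A B, [/\ nbhs t A, nbhs x B &
    forall s y, J s -> D y -> A s -> B y -> `|f t x - f s y| <= eps].
Proof.
move=> /subspace_continuousP cf Jt Dx eps eps0.
have /cvgrPdist_le/(_ eps eps0) := cf (t, x) (conj Jt Dx).
rewrite near_withinE => -[[A B] [/= nA nB] AB].
exists A, B; split=> // s y Js Dy As By.
exact: (AB (s, y) (conj As By) (conj Js Dy)).
Qed.

Lemma mixed_time_space i f t x : st_smooth_on J D f -> J t -> D x ->
  st_partial J None (st_partial J (Some i) f) t x =
  st_partial J (Some i) (st_partial J None f) t x.
Proof.
move=> sf Jt Dx; apply: is_st_partialE => //.
have [r r0 rD] := plane_nbhs 'e_i 'e_i (nbhs_places Dx).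
have line h : `|h| < r -> D (x + h *: 'e_i).
  by move=> hr; have := rD 0 h; rewrite normr0 scale0r addr0; apply.
have x0 : x + 0 *: 'e_i = x :> 'rV[R]_n by rewrite scale0r addr0.
pose f1 := st_partial J None f.
have sf1 : st_smooth_on J D f1 by exact: st_smooth_partial.
have sf12 : st_smooth_on J D (st_partial J (Some i) f1) by exact: st_smooth_partial.
rewrite -{2}x0 /=.
apply: (mixed_tderiv (r := r) (F := fun s h => f s (x + h *: 'e_i))
  (F1 := fun s h => f1 s (x + h *: 'e_i))
  (F12 := fun s h => st_partial J (Some i) f1 s (x + h *: 'e_i)) iJ J2 Jt r0).
- by move=> s h Js hr; apply: (st_smooth_is_partial None sf Js); exact: line.
- move=> s h Js hr; apply/is_derive_lineP.
  by apply: (st_smooth_is_partial (Some i) sf1 Js); exact: line.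
- move=> eps eps0.
  have [A [B [nA nB AB]]] := st_continuous_near (sf12 [::]).1 Jt Dx eps0.
  have [q q0 qB] := plane_nbhs 'e_i 'e_i nB.
  have /nbhs_normP[q' /= q'0 q'A] := nA.
  exists (Num.min q (Num.min q' r)); first by rewrite !lt_min q0 q'0.
  move=> s h Js; rewrite !lt_min x0 => /and3P[_ sq' _] /and3P[hq _ hr].
  apply: AB => //; first exact: line.
    by apply: q'A; rewrite /= distrC.
  by have := qB 0 h; rewrite normr0 scale0r addr0; apply.
- move=> s Js; apply/is_derive_lineP; rewrite x0.
  exact: (st_smooth_is_partial (Some i) sf Js Dx).
Qed.

(** The coordinate j plays the part of time, on a small symmetric interval. *)
Lemma mixed_space i j f t x : st_smooth_on J D f -> J t -> D x ->
  st_partial J (Some j) (st_partial J (Some i) f) t x =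
  st_partial J (Some i) (st_partial J (Some j) f) t x.
Proof.
move=> sf Jt Dx; apply: (is_st_partialE Jt).
have [r r0 rD] := plane_nbhs 'e_j 'e_i (nbhs_places Dx).
pose K := [set s : R | `|s| < r].
have iK : is_interval K.
  move=> a b; rewrite /K /= !ltr_norml => /andP[? ?] /andP[? ?] z /andP[? ?].
  by rewrite ltr_norml; apply/andP; split; lra.
have K2 : exists t0 t1 : R, [/\ K t0, K t1 & t0 < t1].
  by exists 0, (r / 2); rewrite /K /= normr0 gtr0_norm ?divr_gt0 //; split; lra.
have K0 : K 0 by rewrite /K /= normr0.
have nK : nbhs (0 : R) K.
  by apply/nbhs_normP; exists r => // h /=; rewrite sub0r normrN.
pose f1 := st_partial J (Some j) f.
have sf1 : st_smooth_on J D f1 by exact: st_smooth_partial.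
have sf12 : st_smooth_on J D (st_partial J (Some i) f1) by exact: st_smooth_partial.
have x0 (e : 'rV[R]_n) : x + 0 *: e = x by rewrite scale0r addr0.
suff : is_tderiv K (fun s => st_partial J (Some i) f t (x + s *: 'e_j)) 0
    (st_partial J (Some i) f1 t (x + 0 *: 'e_j + 0 *: 'e_i)).
  move=> /(is_tderiv_derive nK); rewrite !x0 => H /=.
  by rewrite -[x in is_derive x](x0 'e_j); apply/is_derive_lineP.
apply: (mixed_tderiv (r := r) (F := fun s h => f t (x + s *: 'e_j + h *: 'e_i))
  (F1 := fun s h => f1 t (x + s *: 'e_j + h *: 'e_i))
  (F12 := fun s h => st_partial J (Some i) f1 t (x + s *: 'e_j + h *: 'e_i))
  iK K2 K0 r0).
- move=> s h Ks hr; apply: is_derive_tderiv.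
  have E k : x + k *: 'e_j + h *: 'e_i = x + h *: 'e_i + k *: 'e_j :> 'rV[R]_n.
    by rewrite addrAC.
  under eq_fun do rewrite E.
  rewrite E; apply/is_derive_lineP; rewrite -E.
  by apply: (st_smooth_is_partial (Some j) sf Jt); exact: rD.
- move=> s h Ks hr; apply/is_derive_lineP.
  by apply: (st_smooth_is_partial (Some i) sf1 Jt); exact: rD.
- move=> eps eps0.
  have [A [B [nA nB AB]]] := st_continuous_near (sf12 [::]).1 Jt Dx eps0.
  have [q q0 qB] := plane_nbhs 'e_j 'e_i nB.
  exists (Num.min q r); first by rewrite lt_min q0.
  move=> s h Ks; rewrite subr0 !x0 !lt_min => /andP[sq _] /andP[hq hr].
  apply: AB => //; [exact: rD|exact: nbhs_singleton nA|exact: qB].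
- move=> s Ks; apply/is_derive_lineP; rewrite scale0r addr0.
  apply: (st_smooth_is_partial (Some i) sf Jt).
  by have := rD s 0 Ks; rewrite normr0 scale0r addr0; apply.
Qed.

Lemma st_partialC d d' f t x : st_smooth_on J D f -> J t -> D x ->
  st_partial J d (st_partial J d' f) t x = st_partial J d' (st_partial J d f) t x.
Proof.
move=> sf Jt Dx; case: d d' => [i|] [j|].
- exact: mixed_space sf Jt Dx.
- by apply: esym; exact: mixed_time_space sf Jt Dx.
- exact: mixed_time_space sf Jt Dx.
- reflexivity.
Qed.

End MixedPartials.

(** * The differential ring of smooth functions *)
Section FunctionRing.
Context {R : realType} {n : nat} (S : stdom R n).
Local Notation J := (times S).
Local Notation D := (places S).
Local Notation smooth := (st_smooth_on J D).

(** Elements vanish outside the domain, so that equality of elements is equality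
    of the functions on the domain ([stfunP]). *)
Record stfun := Stfun {
  stfun_val :> R -> 'rV[R]_n -> R;
  stfun_smooth : smooth stfun_val;
  stfun_out : forall t x, ~ (J t /\ D x) -> stfun_val t x = 0 }.

Implicit Types u v w : stfun.

Lemma stfunP u v : (forall t x, J t -> D x -> u t x = v t x) -> u = v.
Proof.
case: u v => [u su u0] [v sv v0] /= uv.
have E : u = v.
  apply/funext => t; apply/funext => x.
  by have [[Jt Dx]|H] := pselect (J t /\ D x); [exact: uv|rewrite u0 // v0].
move: sv v0; rewrite -E => sv v0; congr Stfun; exact: Prop_irrelevance.
Qed.

Definition restr (f : R -> 'rV[R]_n -> R) t x :=
  if `[< J t /\ D x >] then f t x else 0.

Lemma restrE f t x : J t -> D x -> restr f t x = f t x.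
Proof. by move=> Jt Dx; rewrite /restr asboolT. Qed.

Lemma restr_smooth f : smooth f -> smooth (restr f).
Proof.
move=> /st_smoothP sf; apply/st_smoothP => k; apply: eq_smooth_upto (sf k).
by move=> t x Jt Dx; rewrite restrE.
Qed.

Lemma restr_out f t x : ~ (J t /\ D x) -> restr f t x = 0.
Proof. by move=> H; rewrite /restr asboolF. Qed.

Lemma smooth_cst (c : R) : smooth (fun _ _ => c).
Proof. by apply/st_smoothP => k; exact: smooth_upto_cst. Qed.

(** Total by the junk value 0 on functions that are not smooth. *)
Definition to_stfun (f : R -> 'rV[R]_n -> R) : stfun :=
  if pselect (smooth f) is left sf then Stfun (restr_smooth sf) (@restr_out f)
  else Stfun (restr_smooth (smooth_cst 0)) (@restr_out _).

Lemma to_stfunE f t x : smooth f -> J t -> D x -> to_stfun f t x = f t x.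
Proof.
by move=> sf Jt Dx; rewrite /to_stfun; case: pselect => // ?; exact: restrE.
Qed.

Lemma smoothD u v : smooth (fun t x => u t x + v t x).
Proof.
have /st_smoothP su := stfun_smooth u; have /st_smoothP sv := stfun_smooth v.
by apply/st_smoothP => k; exact: smooth_uptoD.
Qed.

Lemma smoothM u v : smooth (fun t x => u t x * v t x).
Proof.
have /st_smoothP su := stfun_smooth u; have /st_smoothP sv := stfun_smooth v.
by apply/st_smoothP => k; exact: smooth_uptoM.
Qed.

Lemma smoothV u : (forall t x, J t -> D x -> u t x != 0) ->
  smooth (fun t x => (u t x)^-1).
Proof.
move=> u0; have /st_smoothP su := stfun_smooth u.
by apply/st_smoothP => k; exact: smooth_uptoV.
Qed.

(** The operations are obtained from opaque existence statements, so that
    unification does not unfold them into functions. *)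
Fact stfun_cst_exists c :
  {w : stfun | forall t x, J t -> D x -> w t x = c}.
Proof.
by exists (to_stfun (fun _ _ => c)) => t x; apply: to_stfunE; exact: smooth_cst.
Qed.

Fact stfun_add_exists u v :
  {w : stfun | forall t x, J t -> D x -> w t x = u t x + v t x}.
Proof.
exists (to_stfun (fun t x => u t x + v t x)) => t x.
by apply: to_stfunE; exact: smoothD.
Qed.

Fact stfun_mul_exists u v :
  {w : stfun | forall t x, J t -> D x -> w t x = u t x * v t x}.
Proof.
exists (to_stfun (fun t x => u t x * v t x)) => t x.
by apply: to_stfunE; exact: smoothM.
Qed.

Fact pder_exists d u :
  {w : stfun | forall t x, J t -> D x -> w t x = st_partial J d u t x}.
Proof.
exists (to_stfun (st_partial J d u)) => t x.
by apply: to_stfunE; apply: st_smooth_partial; exact: stfun_smooth.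
Qed.

Definition stfun_cst c := sval (stfun_cst_exists c).
Definition stfun_add u v := sval (stfun_add_exists u v).
Definition stfun_mul u v := sval (stfun_mul_exists u v).
Definition stfun_opp u := stfun_mul (stfun_cst (-1)) u.
Definition pder d u := sval (pder_exists d u).

Lemma stfun_cstE c t x : J t -> D x -> stfun_cst c t x = c.
Proof. exact: (svalP (stfun_cst_exists c)). Qed.

Lemma stfun_addE u v t x : J t -> D x -> stfun_add u v t x = u t x + v t x.
Proof. exact: (svalP (stfun_add_exists u v)). Qed.

Lemma stfun_mulE u v t x : J t -> D x -> stfun_mul u v t x = u t x * v t x.
Proof. exact: (svalP (stfun_mul_exists u v)). Qed.

Lemma pderE d u t x : J t -> D x -> pder d u t x = st_partial J d u t x.
Proof. exact: (svalP (pder_exists d u)). Qed.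

Lemma stfun_oppE u t x : J t -> D x -> stfun_opp u t x = - u t x.
Proof. by move=> Jt Dx; rewrite stfun_mulE // stfun_cstE // mulN1r. Qed.

Local Notation sE := (stfun_addE, stfun_mulE, stfun_oppE, stfun_cstE).

Fact stfun_addA : associative stfun_add.
Proof. by move=> u v w; apply: stfunP => *; rewrite !sE // addrA. Qed.

Fact stfun_addC : commutative stfun_add.
Proof. by move=> u v; apply: stfunP => *; rewrite !sE // addrC. Qed.

Fact stfun_add0 : left_id (stfun_cst 0) stfun_add.
Proof. by move=> u; apply: stfunP => *; rewrite !sE // add0r. Qed.

Fact stfun_addN : left_inverse (stfun_cst 0) stfun_opp stfun_add.
Proof. by move=> u; apply: stfunP => *; rewrite !sE // addNr. Qed.

Fact stfun_mulA : associative stfun_mul.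
Proof. by move=> u v w; apply: stfunP => *; rewrite !sE // mulrA. Qed.

Fact stfun_mulC : commutative stfun_mul.
Proof. by move=> u v; apply: stfunP => *; rewrite !sE // mulrC. Qed.

Fact stfun_mul1 : left_id (stfun_cst 1) stfun_mul.
Proof. by move=> u; apply: stfunP => *; rewrite !sE // mul1r. Qed.

Fact stfun_mulDl : left_distributive stfun_mul stfun_add.
Proof. by move=> u v w; apply: stfunP => *; rewrite !sE // mulrDl. Qed.

HB.instance Definition _ := gen_eqMixin stfun.
HB.instance Definition _ := gen_choiceMixin stfun.
HB.instance Definition _ := GRing.isZmodule.Build stfun
  stfun_addA stfun_addC stfun_add0 stfun_addN.

Fact stfun_1_neq0 : stfun_cst 1 != 0 :> stfun.
Proof.
have [t [_ [Jt _ _]]] := times_nondegenerate S; have [x Dx] := places_nonempty S.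
apply/eqP => /(congr1 (fun u : stfun => u t x)).
rewrite stfun_cstE // [RHS](stfun_cstE 0) // => /eqP.
by rewrite oner_eq0.
Qed.

HB.instance Definition _ := GRing.Zmodule_isComNzRing.Build stfun
  stfun_mulA stfun_mulC stfun_mul1 stfun_mulDl stfun_1_neq0.

Section Evaluation.
Variables (t : R) (x : 'rV[R]_n).
Hypotheses (Jt : J t) (Dx : D x).

Lemma stev0 : (0 : stfun) t x = 0. Proof. exact: stfun_cstE. Qed.
Lemma stev1 : (1 : stfun) t x = 1. Proof. exact: stfun_cstE. Qed.
Lemma stevD u v : (u + v) t x = u t x + v t x. Proof. exact: stfun_addE. Qed.
Lemma stevM u v : (u * v) t x = u t x * v t x. Proof. exact: stfun_mulE. Qed.
Lemma stevN u : (- u) t x = - u t x. Proof. exact: stfun_oppE. Qed.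
Lemma stevB u v : (u - v) t x = u t x - v t x. Proof. by rewrite stevD stevN. Qed.

Lemma stev_sum (I : Type) (r : seq I) (P : pred I) (F : I -> stfun) :
  (\sum_(i <- r | P i) F i) t x = \sum_(i <- r | P i) F i t x.
Proof.
by apply: (big_morph (fun u : stfun => u t x)); [exact: stevD|exact: stev0].
Qed.

End Evaluation.

Lemma pderP d u t x : J t -> D x -> is_st_partial S d u t x (pder d u t x).
Proof.
by move=> Jt Dx; rewrite pderE //; apply: st_smooth_is_partial => //; exact: stfun_smooth.
Qed.

Lemma pder_eq d u (f : R -> 'rV[R]_n -> R) t x : J t -> D x ->
  (forall s y, J s -> D y -> u s y = f s y) ->
  st_partial J d f t x = pder d u t x.
Proof.
move=> Jt Dx uf; apply: is_st_partialE => //.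
apply: (eq_is_st_partial Jt Dx) (pderP _ _ Jt Dx); exact: uf.
Qed.

Lemma pder_rule d u t x (v : R) : J t -> D x -> is_st_partial S d u t x v ->
  pder d u t x = v.
Proof. by move=> Jt Dx; rewrite pderE //; exact: is_st_partialE. Qed.

Fact pder_zmod_morphism d : zmod_morphism (pder d).
Proof.
move=> u v; apply: stfunP => t x Jt Dx; apply: pder_rule => //.
apply: (eq_is_st_partial (f := fun t x => u t x + (-1) * v t x)) => //.
  by move=> s y Js Dy; rewrite stevB // mulN1r.
rewrite stevB // -[- (pder d v t x)]mulN1r.
apply: is_st_partialD => //; first exact: pderP.
have := is_st_partialM Jt (is_st_partial_cst S d (-1) t x) (pderP d v Jt Dx).
by rewrite mul0r add0r.
Qed.

HB.instance Definition _ d :=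
  GRing.isZmodMorphism.Build stfun stfun (pder d) (pder_zmod_morphism d).

Lemma pderM d u v : pder d (u * v) = pder d u * v + u * pder d v.
Proof.
apply: stfunP => t x Jt Dx; apply: pder_rule => //.
apply: (eq_is_st_partial (f := fun t x => u t x * v t x)) => //.
  by move=> s y Js Dy; rewrite stevM.
by rewrite stevD // !stevM //; apply: is_st_partialM => //; exact: pderP.
Qed.

Lemma pderC d d' u : pder d (pder d' u) = pder d' (pder d u).
Proof.
apply: stfunP => t x Jt Dx.
rewrite -(@pder_eq d _ (st_partial J d' u)) //; last by move=> *; exact: pderE.
rewrite -(@pder_eq d' _ (st_partial J d u)) //; last by move=> *; exact: pderE.
exact: st_partialC (stfun_smooth u) Jt Dx.
Qed.

Definition stfun_inv u := to_stfun (fun t x => (u t x)^-1).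

Lemma stfun_mulV u : (forall t x, J t -> D x -> u t x != 0) ->
  stfun_inv u * u = 1.
Proof.
move=> u0; apply: stfunP => t x Jt Dx; rewrite stevM // stev1 //.
by rewrite to_stfunE ?mulVf //; [exact: u0|exact: smoothV].
Qed.

End FunctionRing.

(** * Evaluation of the algebraic tensors *)
Lemma act_nth (A : comNzRingType) (n : nat) (L : 'I_n -> 'I_n -> A)
    (T : seq 'I_n -> A) (i0 : 'I_n) (I : seq 'I_n) :
  act L T I =
  \sum_(s < size I) \sum_p L p (nth i0 I s) * T (set_nth i0 I s p).
Proof.
elim: I T => [|i I IH] T /=; first by rewrite big_ord0.
by rewrite big_ord_recl /= IH.
Qed.

Section Representation.
Context {R : realType} {n : nat} (S : stdom R n).
Local Notation J := (times S).
Local Notation D := (places S).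
Local Notation A := (stfun S).

Definition partial_d (o : option 'I_n) : {additive A -> A} := pder o.

Variables (g : seq 'I_n -> A) (gi : 'I_n -> 'I_n -> A).
Variables (t : R) (G : tensor R n).
Hypothesis Jt : J t.

(** T0 gives, at time t, the values of the family T on index lists of length k. *)
Definition agree k (T : seq 'I_n -> A) (T0 : tensor R n) :=
  forall I, size I = k -> forall x, D x -> T I t x = T0 I x.

(** The domain is open, so values on it determine derivatives on it. *)
Lemma partial_spaceE i (u : A) (f : 'rV[R]_n -> R) x : D x ->
  (forall y, D y -> u t y = f y) -> partial_d (Some i) u t x = 'D_('e_i) f x.
Proof.
move=> Dx uf; rewrite [LHS]pderE // [LHS]/=; apply: near_eq_derive.
by apply: filterS (nbhs_places Dx) => y; exact: uf.
Qed.

Local Notation half := (stfun_cst S 2^-1).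
Local Notation Gam := (Gam partial_d half g gi).
Local Notation cov := (cov_deriv partial_d Gam).
Local Notation curv := (curv_up partial_d Gam).
Local Notation Riem := (Riem partial_d half g gi).
Local Notation Ricc := (Ricc partial_d half g gi).
Local Notation RR := (RR partial_d half g gi).

Hypothesis gG : agree 2 g G.
Hypothesis giG : forall i j x, D x -> gi i j t x = ginv G i j x.

Lemma Gam_agree k i j x : D x -> Gam k i j t x = christoffel G k i j x.
Proof.
move=> Dx; rewrite stevM // stfun_cstE // stev_sum //; congr (_ * _).
apply: eq_bigr => l _; rewrite stevM // giG // stevB // stevD //.
by congr (_ * (_ + _ - _)); apply: partial_spaceE => // y Dy; exact: gG.
Qed.

Lemma cov_agree k T T0 : agree k T T0 -> agree k.+1 (cov T) (nabla G T0).
Proof.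
move=> TT [|m I] // [sI] x Dx; rewrite /cov /nabla stevB //; congr (_ - _).
  by apply: partial_spaceE => // y Dy; exact: TT.
rewrite (act_nth _ _ m) stev_sum //; apply: eq_bigr => s _.
rewrite stev_sum //; apply: eq_bigr => p _; rewrite stevM // Gam_agree // TT //.
by rewrite size_set_nth (maxn_idPr _) // -sI.
Qed.

Lemma curv_agree k i j l x : D x -> curv k i j l t x = riemann_up G k i j l x.
Proof.
move=> Dx; rewrite stevD // stevB // stev_sum //; congr (_ - _ + _).
- by apply: partial_spaceE => // y; exact: Gam_agree.
- by apply: partial_spaceE => // y; exact: Gam_agree.
- apply: eq_bigr => p _.
  have E (u v w z : A) : (u * v - w * z) t x = u t x * v t x - w t x * z t x.
    by rewrite stevB // !stevM.
  by rewrite E; congr (_ * _ - _ * _); exact: Gam_agree.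
Qed.

Lemma Riem_agree : agree 4 Riem (Rm G).
Proof.
apply: size4_ind => i j k l x Dx; rewrite stev_sum //; apply: eq_bigr => p _.
by rewrite stevM // curv_agree // gG.
Qed.

Lemma tr_agree (f : 'I_n -> 'I_n -> A) (f0 : 'I_n -> 'I_n -> R) x : D x ->
  (forall p q, f p q t x = f0 p q) ->
  tr gi f t x = \sum_p \sum_q ginv G p q x * f0 p q.
Proof.
move=> Dx ff; rewrite stev_sum //; apply: eq_bigr => p _.
by rewrite stev_sum //; apply: eq_bigr => q _; rewrite stevM // giG // ff.
Qed.

Lemma Ricc_agree : agree 2 Ricc (Ric G).
Proof.
apply: size2_ind => i k x Dx; apply: tr_agree => // j l.
exact: Riem_agree.
Qed.

Lemma quad_agree (f h : 'I_n -> 'I_n -> A) (f0 h0 : 'I_n -> 'I_n -> R) x : D x ->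
  (forall p q, f p q t x = f0 p q) -> (forall p q, h p q t x = h0 p q) ->
  quad gi f h t x = \sum_p \sum_q \sum_r \sum_s
    ginv G p r x * ginv G q s x * f0 p q * h0 r s.
Proof.
move=> Dx ff hh; rewrite stev_sum //; apply: eq_bigr => p _.
rewrite stev_sum //; apply: eq_bigr => q _; rewrite stev_sum //.
apply: eq_bigr => r _; rewrite stev_sum //; apply: eq_bigr => s _.
by rewrite !stevM // !giG // ff hh.
Qed.

Lemma RR_agree : agree 4 RR (RmRm G).
Proof.
by apply: size4_ind => i j k l x Dx; apply: quad_agree => // p q; exact: Riem_agree.
Qed.

Lemma two_form_square_agree F F0 :
  agree 2 F F0 -> agree 2 (two_form_square gi F) (trFF G F0).
Proof.
move=> FF; apply: size2_ind => i j x Dx; rewrite stev_sum //; apply: eq_bigr => p _.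
rewrite stev_sum //; apply: eq_bigr => q _.
by rewrite !stevM // giG // !FF.
Qed.

Lemma three_form_square_agree H H0 :
  agree 3 H H0 -> agree 2 (three_form_square gi H) (trHH G H0).
Proof.
move=> HH; apply: size2_ind => i j x Dx.
by apply: quad_agree => // p q; exact: HH.
Qed.

Lemma ext1_agree B B0 : agree 1 B B0 -> agree 2 (ext1 partial_d B) (d1 B0).
Proof.
move=> BB; apply: size2_ind => i j x Dx; rewrite stevB //.
by congr (_ - _); apply: partial_spaceE => // y; exact: BB.
Qed.

Lemma ext2_agree B B0 : agree 2 B B0 -> agree 3 (ext2 partial_d B) (d2 B0).
Proof.
move=> BB; apply: size3_ind => i j k x Dx; rewrite !stevD //.
by congr (_ + _ + _); apply: partial_spaceE => // y; exact: BB.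
Qed.

End Representation.

(** * The evolution equation in a chart and on the manifold *)
Section InverseMetric.
Context {R : realType} {n : nat} (S : stdom R n).
Local Notation J := (times S).
Local Notation D := (places S).
Local Notation A := (stfun S).
Variable g : seq 'I_n -> A.
Hypothesis gsym : forall i j, g [:: i; j] = g [:: j; i].
Variable G : R -> tensor R n.
Hypothesis gG : forall t, J t -> agree t 2 g (G t).
Hypothesis Gpos : forall t x, J t -> D x -> forall v : 'rV[R]_n, v != 0 ->
  0 < (v *m metric_mx (G t) x *m v^T) 0 0.

Definition gmx : 'M[A]_n := \matrix_(i, j) g [:: i; j].

(** Cramer's formula, so that smoothness of the inverse metric only requires
    that of 1/det. *)
Definition ginvA i j : A := stfun_inv (\det gmx) * (\adj gmx) i j.

Lemma stev_prod (I : Type) (r : seq I) (P : pred I) (F : I -> A) t x : J t -> D x ->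
  (\prod_(i <- r | P i) F i) t x = \prod_(i <- r | P i) F i t x.
Proof.
move=> Jt Dx; apply: (big_morph (fun u : A => u t x)).
  by move=> u v; exact: stevM.
exact: stev1.
Qed.

Lemma stev_det (M : 'M[A]_n) t x : J t -> D x ->
  (\det M) t x = \det (\matrix_(i, j) M i j t x).
Proof.
move=> Jt Dx; rewrite /determinant stev_sum //; apply: eq_bigr => s _.
rewrite stevM // stev_prod //; congr (_ * _).
  by case: (perm.odd_perm s); rewrite ?expr1 ?expr0 ?stevN // stev1.
by apply: eq_bigr => i _; rewrite mxE.
Qed.

Lemma gmx_ev t x : J t -> D x -> \matrix_(i, j) gmx i j t x = metric_mx (G t) x.
Proof.
by move=> Jt Dx; apply/matrixP => i j; rewrite !mxE; exact: gG.
Qed.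

(** A null vector of a positive definite matrix vanishes. *)
Lemma metric_det_neq0 t x : J t -> D x -> \det (metric_mx (G t) x) != 0.
Proof.
move=> Jt Dx; apply/det0P => -[v v0 vM].
by have := Gpos Jt Dx v0; rewrite vM mul0mx mxE ltxx.
Qed.

Lemma ginvA_sym i j : ginvA i j = ginvA j i.
Proof.
rewrite /ginvA; congr (_ * _).
have E : gmx^T = gmx by apply/matrixP => a b; rewrite !mxE gsym.
by rewrite -{1}E -trmx_adj mxE.
Qed.

Lemma ginvAP i j : \sum_p ginvA i p * g [:: p; j] = (i == j)%:R.
Proof.
have := mul_adj_mx gmx => /matrixP/(_ i j); rewrite [LHS]mxE [RHS]mxE => E.
transitivity (stfun_inv (\det gmx) * (\det gmx *+ (i == j))).
  rewrite -E mulr_sumr; apply: eq_bigr => p _.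
  by rewrite /ginvA [gmx p j]mxE mulrA.
rewrite mulrnAr stfun_mulV // => t x Jt Dx.
by rewrite stev_det // gmx_ev //; exact: metric_det_neq0.
Qed.

Lemma ginvA_agree t x i j : J t -> D x -> ginvA i j t x = ginv (G t) i j x.
Proof.
move=> Jt Dx; pose GI : 'M[R]_n := \matrix_(i, j) ginvA i j t x.
have U : metric_mx (G t) x \in unitmx.
  by rewrite unitmxE unitfE; exact: metric_det_neq0.
have E : GI *m metric_mx (G t) x = 1%:M.
  apply/matrixP => a b; rewrite !mxE.
  have := congr1 (fun u : A => u t x) (ginvAP a b).
  rewrite stev_sum // => H.
  have -> : (a == b)%:R = ((a == b)%:R : A) t x.
    by case: (a == b); rewrite ?stev1 ?stev0.
  rewrite -H; apply: eq_bigr => p _; rewrite !mxE stevM //; congr (_ * _).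
  by apply/esym; exact: gG.
by rewrite /ginv -[invmx _]mul1mx -E mulmxK // mxE.
Qed.

Variables (a b : seq 'I_n -> A) (W B : R -> tensor R n).
Hypothesis aW : forall t, J t -> agree t 1 a (W t).
Hypothesis bB : forall t, J t -> agree t 2 b (B t).
Hypothesis flow : forall t x, J t -> D x -> forall i j : 'I_n,
  is_tderiv J (fun s => G s [:: i; j] x) t
    (- 2 * (Ric (G t) [:: i; j] x - 4^-1 * trHH (G t) (d2 (B t)) [:: i; j] x
            - trFF (G t) (d1 (W t)) [:: i; j] x)).

Local Notation half := (stfun_cst S 2^-1).
Local Notation quarter := (stfun_cst S 4^-1).
Local Notation d := (partial_d S).
Local Notation HA := (three_form_square ginvA (ext2 d b)).
Local Notation FA := (two_form_square ginvA (ext1 d a)).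

Lemma halfP : half + half = 1.
Proof.
apply: stfunP => s y Js Dy; rewrite (stevD Js Dy) (stev1 Js Dy) (stfun_cstE _ Js Dy).
by rewrite [RHS]splitr mul1r.
Qed.

Lemma quarterP : quarter = half * half.
Proof.
apply: stfunP => s y Js Dy; rewrite (stevM Js Dy) !(stfun_cstE _ Js Dy).
by rewrite -invfM -natrM.
Qed.

Lemma ginvA_agree_at t : J t -> forall i j x, D x ->
  ginvA i j t x = ginv (G t) i j x.
Proof. by move=> Jt i j x; exact: ginvA_agree. Qed.

Lemma HA_agree t : J t -> agree t 2 HA (trHH (G t) (d2 (B t))).
Proof.
move=> Jt; apply: (three_form_square_agree Jt (ginvA_agree_at Jt)).
apply: (ext2_agree Jt); exact: bB.
Qed.

Lemma FA_agree t : J t -> agree t 2 FA (trFF (G t) (d1 (W t))).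
Proof.
move=> Jt; apply: (two_form_square_agree Jt (ginvA_agree_at Jt)).
apply: (ext1_agree Jt); exact: aW.
Qed.

Local Notation RicA := (Ricc d half g ginvA).
Local Notation RmA := (Riem d half g ginvA).
Local Notation RRA := (RR d half g ginvA).
Local Notation covA := (cov_deriv d (Gam d half g ginvA)).

(** The equation for g holds at all times and points of the domain, hence as an
    identity in the ring, where it can be differentiated. *)
Lemma flowA i j : d None (g [:: i; j]) =
  - (1 + 1) * (RicA [:: i; j] - quarter * HA [:: i; j] - FA [:: i; j]).
Proof.
apply: stfunP => t x Jt Dx.
have E (u v w z : A) : (- (1 + 1) * (u - v * w - z)) t x =
    - 2 * (u t x - v t x * w t x - z t x).
  have c2 : (- (1 + 1) : A) t x = - 2.
    by rewrite (stevN Jt Dx (1 + 1)) (stevD Jt Dx 1 1) (stev1 Jt Dx).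
  rewrite (stevM Jt Dx (- (1 + 1)) (u - v * w - z)) c2.
  by rewrite (stevB Jt Dx (u - v * w) z) (stevB Jt Dx u (v * w)) (stevM Jt Dx v w).
have Ric_tx : RicA [:: i; j] t x = Ric (G t) [:: i; j] x.
  exact: (Ricc_agree Jt (gG Jt) (ginvA_agree_at Jt)).
have HH_tx : HA [:: i; j] t x = trHH (G t) (d2 (B t)) [:: i; j] x.
  exact: (HA_agree Jt).
have FF_tx : FA [:: i; j] t x = trFF (G t) (d1 (W t)) [:: i; j] x.
  exact: (FA_agree Jt).
rewrite E Ric_tx HH_tx FF_tx (stfun_cstE _ Jt Dx).
apply: (pder_rule Jt Dx).
have H : is_st_partial S None (fun s y => G s [:: i; j] y) t x _ :=
  @flow t x Jt Dx i j.
apply: (eq_is_st_partial Jt Dx _ H) => s y Js Dy.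
by apply: esym; exact: (gG Js).
Qed.

Lemma chart_curvature_evolution t x (i j k l : 'I_n) : J t -> D x ->
  let Rm_ := Rm (G t) in
  let Rc := Ric (G t) in
  let BB := RmRm (G t) in
  let HH := trHH (G t) (d2 (B t)) in
  let FF := trFF (G t) (d1 (W t)) in
  let nabla2 := fun T : tensor R n => nabla (G t) (nabla (G t) T) in
  is_tderiv J (fun s => Rm (G s) [:: i; j; k; l] x) t
    (laplacian (G t) Rm_ [:: i; j; k; l] x
     + 2 * (BB [:: i; j; k; l] x - BB [:: i; j; l; k] x
            - BB [:: i; l; j; k] x + BB [:: i; k; j; l] x)
     - \sum_(p < n) \sum_(q < n) ginv (G t) p q x *
         (Rm_ [:: p; j; k; l] x * Rc [:: q; i] x
          + Rm_ [:: i; p; k; l] x * Rc [:: q; j] x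
          + Rm_ [:: i; j; p; l] x * Rc [:: q; k] x
          + Rm_ [:: i; j; k; p] x * Rc [:: q; l] x)
     + 4^-1 * (nabla2 HH [:: i; l; k; j] x - nabla2 HH [:: i; k; j; l] x
               - nabla2 HH [:: j; l; k; i] x + nabla2 HH [:: j; k; i; l] x)
     + 4^-1 * \sum_(m < n) \sum_(p < n) ginv (G t) m p x *
         (HH [:: k; m] x * Rm_ [:: i; j; p; l] x
          + HH [:: m; l] x * Rm_ [:: i; j; k; p] x)
     + (nabla2 FF [:: i; l; k; j] x - nabla2 FF [:: i; k; j; l] x
        - nabla2 FF [:: j; l; k; i] x + nabla2 FF [:: j; k; i; l] x)
     + \sum_(m < n) \sum_(p < n) ginv (G t) m p x *
         (FF [:: k; m] x * Rm_ [:: i; j; p; l] x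
          + FF [:: m; l] x * Rm_ [:: i; j; k; p] x)).
Proof.
move=> Jt Dx Rm_ Rc BB HH FF nabla2.
have gi_t := ginvA_agree_at Jt.
have Rm_t I : size I = 4%N -> RmA I t x = Rm_ I x.
  by move=> sI; exact: (Riem_agree Jt (gG Jt) gi_t).
have Rc_t I : size I = 2%N -> RicA I t x = Rc I x.
  by move=> sI; exact: (Ricc_agree Jt (gG Jt) gi_t).
have BB_t I : size I = 4%N -> RRA I t x = BB I x.
  by move=> sI; exact: (RR_agree Jt (gG Jt) gi_t).
have HH_t I : size I = 2%N -> HA I t x = HH I x.
  by move=> sI; exact: (HA_agree Jt).
have FF_t I : size I = 2%N -> FA I t x = FF I x.
  by move=> sI; exact: (FA_agree Jt).
have cov2_t k' T T0 I : agree t k' T T0 -> size I = k'.+2 ->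
    covA (covA T) I t x = nabla2 T0 I x.
  move=> TT sI.
  exact: (cov_agree Jt (gG Jt) gi_t (cov_agree Jt (gG Jt) gi_t TT)).
have := curvature_evolution (@pderM _ _ S) (@pderC _ _ S) halfP gsym ginvA_sym
  ginvAP (three_form_square_sym ginvA_sym (ext2 d b)) (two_form_square_sym ginvA_sym (ext1 d a))
  quarterP flowA i j k l.
move=> /(congr1 (fun u : A => u t x)).
have H : is_st_partial S None (RmA [:: i; j; k; l]) t x _ := pderP None _ Jt Dx.
have {H} : is_tderiv J (fun s => Rm (G s) [:: i; j; k; l] x) t
    (d None (RmA [:: i; j; k; l]) t x).
  apply: eq_is_tderiv Jt _ H => s Js.
  exact: (Riem_agree Js (gG Js) (ginvA_agree_at Js)).
move=> dRm e; rewrite e in dRm => {e}.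
have eq_value v w : v = w -> is_tderiv J (fun s => Rm (G s) [:: i; j; k; l] x) t v ->
    is_tderiv J (fun s => Rm (G s) [:: i; j; k; l] x) t w by move=> ->.
apply: eq_value dRm.
(* Evaluation is pushed through each shape of expression in variables first, so
   that it does not enter the geometric quantities standing for them. *)
have ev_total (u1 u2 u3 u4 u5 u6 u7 : A) :
    (u1 + u2 - u3 + u4 + u5 + u6 + u7) t x =
    u1 t x + u2 t x - u3 t x + u4 t x + u5 t x + u6 t x + u7 t x.
  by rewrite !(stevD Jt Dx) (stevN Jt Dx).
have ev_alt (u1 u2 u3 u4 : A) :
    (u1 - u2 - u3 + u4) t x = u1 t x - u2 t x - u3 t x + u4 t x.
  by rewrite !(stevD Jt Dx) !(stevN Jt Dx).
have ev_two (u v w z : A) : (u * v + w * z) t x = u t x * v t x + w t x * z t x.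
  by rewrite (stevD Jt Dx) !(stevM Jt Dx).
have ev_four (u1 u2 u3 u4 v1 v2 v3 v4 : A) :
    (u1 * v1 + u2 * v2 + u3 * v3 + u4 * v4) t x =
    u1 t x * v1 t x + u2 t x * v2 t x + u3 t x * v3 t x + u4 t x * v4 t x.
  by rewrite !(stevD Jt Dx) !(stevM Jt Dx).
have ev_double (u : A) : ((1 + 1) * u) t x = 2 * u t x.
  by rewrite (stevM Jt Dx) (stevD Jt Dx) (stev1 Jt Dx).
have ev_quarter (u : A) : (quarter * u) t x = 4^-1 * u t x.
  by rewrite (stevM Jt Dx) (stfun_cstE _ Jt Dx).
have cov2_HH := fun I => cov2_t _ _ _ I (HA_agree Jt).
have cov2_FF := fun I => cov2_t _ _ _ I (FA_agree Jt).
rewrite ev_total; congr (_ + _ - _ + _ + _ + _ + _).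
- apply: (tr_agree Jt gi_t Dx) => p q.
  exact: (cov2_t _ _ _ _ (Riem_agree Jt (gG Jt) gi_t)).
- by rewrite ev_double ev_alt; congr (_ * (_ - _ - _ + _)); exact: BB_t.
- apply: (tr_agree Jt gi_t Dx) => p q; rewrite ev_four.
  by congr (_ * _ + _ * _ + _ * _ + _ * _); (exact: Rm_t || exact: Rc_t).
- by rewrite ev_quarter ev_alt; congr (_ * (_ - _ - _ + _)); exact: cov2_HH.
- rewrite ev_quarter; congr (_ * _); apply: (tr_agree Jt gi_t Dx) => m p.
  by rewrite ev_two; congr (_ * _ + _ * _); (exact: HH_t || exact: Rm_t).
- by rewrite ev_alt; congr (_ - _ - _ + _); exact: cov2_FF.
- apply: (tr_agree Jt gi_t Dx) => m p.
  by rewrite ev_two; congr (_ * _ + _ * _); (exact: FF_t || exact: Rm_t).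
Qed.

End InverseMetric.

Lemma smooth_component (R : realType) (n : nat) (M : smooth_manifold R n)
    (J : set R) (k : nat) (T : tensor_flow M) (a : chart_index M) (I : seq 'I_n) :
  is_smooth_tensor_flow J k T -> size I = k ->
  st_smooth_on J (cimg (charts a)) (fun t => T a t I).
Proof. by move=> [sT _] /eqP sI; exact: (sT a (Tuple sI)). Qed.

Unset Implicit Arguments.

Theorem theorem5p1 (R : realType) (n : nat) (M : smooth_manifold R n)
    (hM : compact [set: M])
    (J : set R) (hJ : is_interval J)
    (hJ' : exists t0 t1 : R, [/\ J t0, J t1 & t0 < t1])
    (g A B : tensor_flow M) (hsol : is_smooth_solution J g A B)
    (a : chart_index M) (t : R) (x : 'rV[R]_n)
    (ht : J t) (hx : cimg (charts a) x) (i j k l : 'I_n) :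
  let G := g a t in
  let Rm_ := Rm G in
  let Rc := Ric G in
  let BB := RmRm G in
  let HH := trHH G (d2 (B a t)) in
  let FF := trFF G (d1 (A a t)) in
  let nabla2 := fun T : tensor R n => nabla G (nabla G T) in
  is_tderiv J (fun s => Rm (g a s) [:: i; j; k; l] x) t
    (laplacian G Rm_ [:: i; j; k; l] x
     + 2 * (BB [:: i; j; k; l] x - BB [:: i; j; l; k] x
            - BB [:: i; l; j; k] x + BB [:: i; k; j; l] x)
     - \sum_(p < n) \sum_(q < n) ginv G p q x *
         (Rm_ [:: p; j; k; l] x * Rc [:: q; i] x
          + Rm_ [:: i; p; k; l] x * Rc [:: q; j] x
          + Rm_ [:: i; j; p; l] x * Rc [:: q; k] x
          + Rm_ [:: i; j; k; p] x * Rc [:: q; l] x)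
     + 4^-1 * (nabla2 HH [:: i; l; k; j] x - nabla2 HH [:: i; k; j; l] x
               - nabla2 HH [:: j; l; k; i] x + nabla2 HH [:: j; k; i; l] x)
     + 4^-1 * \sum_(m < n) \sum_(p < n) ginv G m p x *
         (HH [:: k; m] x * Rm_ [:: i; j; p; l] x
          + HH [:: m; l] x * Rm_ [:: i; j; k; p] x)
     + (nabla2 FF [:: i; l; k; j] x - nabla2 FF [:: i; k; j; l] x
        - nabla2 FF [:: j; l; k; i] x + nabla2 FF [:: j; k; i; l] x)
     + \sum_(m < n) \sum_(p < n) ginv G m p x *
         (FF [:: k; m] x * Rm_ [:: i; j; p; l] x
          + FF [:: m; l] x * Rm_ [:: i; j; k; p] x)).
Proof.
move=> G Rm_ Rc BB HH FF nabla2.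
have [[sg metric_g] sA [sB _] flow] := hsol.
pose S := Stdom hJ hJ' (@cimg_open _ _ _ (charts a)) (ex_intro _ x hx).
pose comp (T : tensor_flow M) I := to_stfun S (fun s => T a s I).
have compP k' (T : tensor_flow M) : is_smooth_tensor_flow J k' T ->
    forall s, times S s -> agree s k' (comp T) (T a s).
  move=> sT s Js I sI y Dy; apply: (to_stfunE (S := S) _ Js Dy).
  exact: smooth_component sT sI.
have gsym i' j' : comp g [:: i'; j'] = comp g [:: j'; i'].
  apply: stfunP => s y Js Dy; rewrite !(compP _ _ sg _ Js _ _ _ Dy) //.
  by have [] := metric_g a s y Js Dy.
apply: (@chart_curvature_evolution _ _ S (comp g) gsym (g a) (compP _ _ sg) _
  (comp A) (comp B) (A a) (B a) (compP _ _ sA) (compP _ _ sB)) => //.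
  by move=> s y Js Dy; have [] := metric_g a s y Js Dy.
by move=> s y Js Dy; have [] := flow a s y Js Dy.
Qed.
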